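(* Let $\mathfrak g=gl(m|n)$, and let $\chi\in\mathfrak g_{\bar 0}^*$, $\mathfrak P$ and $\mathfrak N=\mathfrak N_{\bar 0}\oplus\mathfrak N_{\bar 1}$ be as in the context. Let $M=M_{\bar 0}\oplus M_{\bar 1}$ be a simple $u(\mathfrak g,\chi)$-module and $M'\subseteq M$ a $\mathbf Z_2$-graded simple $u(\mathfrak P,\chi)$-submodule. Then $$M\cong u(\mathfrak g,\chi)\otimes_{u(\mathfrak P,\chi)}M'.$$ In particular, $$\dim M=p^{\dim\mathfrak N_{\bar 0}}\,2^{\dim\mathfrak N_{\bar 1}}\dim M'.$$
   Context: $\mathbf F$ is an algebraically closed field of characteristic $p>3$, $(m,n)\neq (1,1)$, and $\mathfrak g=gl(m|n)$ is the restricted Lie superalgebra with matrix units $e_{ij}$, $\mathfrak g_{\bar 0}=gl(m)\oplus gl(n)$, $p$-mapping the $p$-th matrix power, Cartan subalgebra $H=\langle e_{ii}\rangle$. The root system $\Phi=\Phi_0\cup\Phi_1$ is taken with the natural simple roots $\Delta=\{\epsilon_1-\epsilon_2,\dots,\epsilon_m-\delta_1,\dots,\delta_{n-1}-\delta_n\}$, so the positive root vectors are the $e_{ij}$ with $i<j$; $e_\alpha$, $f_\alpha$ denote the matrix units of weights $\alpha$, $-\alpha$ and $h_\alpha=[e_\alpha,f_\alpha]$. $N^+=\sum_{\alpha>0}\mathfrak g_\alpha$, $\mathfrak B=H+N^+$. For $\chi\in\mathfrak g_{\bar 0}^*$ (extended by $\chi(\mathfrak g_{\bar 1})=0$), $u(\mathfrak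 g,\chi)$ is the quotient of $U(\mathfrak g)$ by the two-sided ideal generated by $x^p-x^{[p]}-\chi(x)^p1$, $x\in\mathfrak g_{\bar 0}$; similarly for restricted subalgebras. Modules are $\mathbf Z_2$-graded; simple means no proper nonzero $\mathbf Z_2$-graded submodule. $\chi$ is assumed to vanish on $N^+$ (every $\chi$ is conjugate to such a one). Let $\chi=\chi_s+\chi_n$ be its decomposition into semisimple part $\chi_s$ and nilpotent part $\chi_n$, where $\chi_s$ agrees with $\chi$ on $H$ and vanishes on all root vectors, and $\chi_n$ vanishes on $H$ and on $\mathfrak g_{-\alpha}$ whenever $\chi(h_\alpha)\ne0$; thus $\chi(\mathfrak g_{\alpha})=0$ for all $\alpha\in\Phi^+\cup -\Phi'$, where $\Phi'=\{\alpha\in\Phi^+\mid\chi(h_\alpha)\neq0\}$. Put $\mathfrak l'=C_{\mathfrak g}(\chi_s)=\{x\in\mathfrak g\mid\chi_s([x,\mathfrak g])=0\}=H\oplus\sum_{\chi(h_\alpha)=0}\mathfrak g_\alpha$ and $\mathfrak l=[\mathfrak l',\mathfrak l']$. $\mathfrak P=\mathfrak B+\mathfrak l$; the setting is that $\mathfrak P$ is a parabolic subalgebra of $\mathfrak g$ whose nilradical is $\mathfrak N=\sum_{\alpha\in\Phi'}\mathfrak g_\alpha=\mathfrak N_{\bar 0}\oplus\mathfrak N_{\bar 1}$, where $\mathfrak N_{\bar i}$ is the sum of the $\mathfrak g_\alpha$ with $\alpha\in\Phi'$ of parity $\bar i$. *)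

(* Defs.v *)
(* boolp is used to form quotients by undecidable congruences. *)
From HB Require Import structures.
From mathcomp Require Import all_boot all_order all_algebra.
From mathcomp Require Import boolp.
From mathcomp Require Import monalg.

Set Implicit Arguments.
Unset Strict Implicit.
Unset Printing Implicit Defensive.

Import GRing.Theory.
Local Open Scope ring_scope.

(* Quotient of a ring by the two-sided ideal generated by S. The quotient may be
   the zero ring, so only a pzRingType structure is available on it. *)
Section RingQuotient.
Variables (A : pzRingType) (S : A -> Prop).

Inductive ideal_gen : A -> Prop :=
| ideal_gen0 : ideal_gen 0
| ideal_genS s : S s -> ideal_gen s
| ideal_genB x y : ideal_gen x -> ideal_gen y -> ideal_gen (x - y)
| ideal_genM a b x : ideal_gen x -> ideal_gen (a * x * b).

Definition ideal_pred : pred A := fun x => `[< ideal_gen x >].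

Lemma ideal_predP x : reflect (ideal_gen x) (x \in ideal_pred).
Proof. exact: asboolP. Qed.

Fact ideal_zmod_closed : zmod_closed ideal_pred.
Proof.
split; first exact/ideal_predP/ideal_gen0.
by move=> x y /ideal_predP hx /ideal_predP hy; apply/ideal_predP/ideal_genB.
Qed.
HB.instance Definition _ := GRing.isZmodClosed.Build A ideal_pred ideal_zmod_closed.

Local Notation ideal_quot := (Quotient.quot (GRing.ZmodClosed.clone A ideal_pred _)).
Definition ringquot : Type := ideal_quot.
HB.instance Definition _ := GRing.Zmodule.on ringquot.

Definition rq (x : A) : ringquot := (\pi_(ideal_quot) x)%qT.

Lemma rq_eq x y : (rq x = rq y) <-> ideal_gen (x - y).
Proof.
split; first by move=> /eqP; rewrite -Quotient.idealrBE => /ideal_predP.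
by move=> /ideal_predP h; apply/eqP; rewrite -Quotient.idealrBE.
Qed.

Fact rq_is_additive : zmod_morphism rq.
Proof. by move=> x y; rewrite /rq (raddfB (\pi_(ideal_quot))%qT). Qed.
HB.instance Definition _ := GRing.isZmodMorphism.Build A ringquot rq rq_is_additive.

Definition rq_repr (q : ringquot) : A :=
  generic_quotient.repr (q : ideal_quot).
Definition rq_mul (q r : ringquot) : ringquot := rq (rq_repr q * rq_repr r).

Lemma rq_reprK q : rq (rq_repr q) = q.
Proof. exact: generic_quotient.reprK. Qed.

Lemma rq_mulE x y : rq_mul (rq x) (rq y) = rq (x * y).
Proof.
have h z : ideal_gen (rq_repr (rq z) - z) by apply/rq_eq/rq_reprK.
apply/rq_eq; set x' := rq_repr _; set y' := rq_repr _.
have -> : x' * y' - x * y = 1 * (x' - x) * y' - (0 - x * (y' - y) * 1).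
  by rewrite mul1r mulr1 sub0r opprK mulrBl mulrBr addrA subrK.
apply: ideal_genB; first by apply: ideal_genM; apply: h.
by apply: ideal_genB; [exact: ideal_gen0|apply: ideal_genM; apply: h].
Qed.

Fact rq_mulA : associative rq_mul.
Proof.
by move=> x y z; rewrite -[x]rq_reprK -[y]rq_reprK -[z]rq_reprK !rq_mulE mulrA.
Qed.
Fact rq_mul1 : left_id (rq 1) rq_mul.
Proof. by move=> x; rewrite -[x]rq_reprK !rq_mulE mul1r. Qed.
Fact rq_1mul : right_id (rq 1) rq_mul.
Proof. by move=> x; rewrite -[x]rq_reprK !rq_mulE mulr1. Qed.
Fact rq_mulDl : left_distributive rq_mul +%R.
Proof.
move=> x y z; rewrite -[x]rq_reprK -[y]rq_reprK -[z]rq_reprK.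
by rewrite -raddfD !rq_mulE mulrDl raddfD.
Qed.
Fact rq_mulDr : right_distributive rq_mul +%R.
Proof.
move=> x y z; rewrite -[x]rq_reprK -[y]rq_reprK -[z]rq_reprK.
by rewrite -raddfD !rq_mulE mulrDr raddfD.
Qed.
HB.instance Definition _ := GRing.Zmodule_isPzRing.Build ringquot
  rq_mulA rq_mul1 rq_1mul rq_mulDl rq_mulDr.

Fact rq_is_monoid_morphism : monoid_morphism rq.
Proof. by split=> // x y; rewrite -rq_mulE. Qed.
HB.instance Definition _ :=
  GRing.isMonoidMorphism.Build A ringquot rq rq_is_monoid_morphism.

Section Lift.
Variables (B : pzRingType) (f : {rmorphism A -> B}).
Hypothesis fS : forall s, S s -> f s = 0.

Lemma ideal_gen_ker x : ideal_gen x -> f x = 0.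
Proof.
elim=> [|s /fS//|u v _ fu _ fv|a b u _ fu]; first exact: rmorph0.
  by rewrite rmorphB fu fv subr0.
by rewrite !rmorphM fu mulr0 mul0r.
Qed.

Definition rq_lift (_ : forall s, S s -> f s = 0) (q : ringquot) : B :=
  f (rq_repr q).

Lemma rq_liftE x : rq_lift fS (rq x) = f x.
Proof.
apply/eqP; rewrite -subr_eq0 -rmorphB; apply/eqP/ideal_gen_ker/rq_eq.
exact: rq_reprK.
Qed.

Fact rq_lift_zmod_morphism : zmod_morphism (rq_lift fS).
Proof.
move=> x y; rewrite -[x]rq_reprK -[y]rq_reprK -raddfB !rq_liftE.
exact: rmorphB.
Qed.
Fact rq_lift_monoid_morphism : monoid_morphism (rq_lift fS).
Proof.
split; first by rewrite (rq_liftE 1) rmorph1.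
move=> x y; rewrite -[x]rq_reprK -[y]rq_reprK -rmorphM !rq_liftE.
exact: rmorphM.
Qed.
HB.instance Definition _ :=
  GRing.isZmodMorphism.Build ringquot B (rq_lift fS) rq_lift_zmod_morphism.
HB.instance Definition _ :=
  GRing.isMonoidMorphism.Build ringquot B (rq_lift fS) rq_lift_monoid_morphism.
End Lift.
End RingQuotient.

(* The left A-module A \otimes_B V, where A is a right B-module through f.
   {malg A[V]} is the group of finite formal sums of symbols << a *g v >>, already
   additive in a : A. *)
Section Tensor.
Variables (A B : pzRingType) (f : {rmorphism B -> A}) (V : lmodType B).

Inductive tens_rel : {malg A[V]} -> Prop :=
| tens_rel0 : tens_rel 0
| tens_relB x y : tens_rel x -> tens_rel y -> tens_rel (x - y)
| tens_relD a v w :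
    tens_rel (<< a *g v + w >> - << a *g v >> - << a *g w >>)
| tens_relM a b v :
    tens_rel (<< a * f b *g v >> - << a *g b *: v >>).

Definition tens_pred : pred {malg A[V]} := fun x => `[< tens_rel x >].

Lemma tens_predP x : reflect (tens_rel x) (x \in tens_pred).
Proof. exact: asboolP. Qed.

Fact tens_zmod_closed : zmod_closed tens_pred.
Proof.
split; first exact/tens_predP/tens_rel0.
by move=> x y /tens_predP hx /tens_predP hy; apply/tens_predP/tens_relB.
Qed.
HB.instance Definition _ :=
  GRing.isZmodClosed.Build {malg A[V]} tens_pred tens_zmod_closed.

Local Notation tens_quot := (Quotient.quot (GRing.ZmodClosed.clone {malg A[V]} tens_pred _)).
Definition tensor : Type := tens_quot.
HB.instance Definition _ := GRing.Zmodule.on tensor.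

Definition tens_pi (x : {malg A[V]}) : tensor :=
  (\pi_(tens_quot) x)%qT.
Definition tens_repr (t : tensor) : {malg A[V]} :=
  generic_quotient.repr (t : tens_quot).

Lemma tens_reprK t : tens_pi (tens_repr t) = t.
Proof. exact: generic_quotient.reprK. Qed.

Lemma tens_pi_eq x y : (tens_pi x = tens_pi y) <-> tens_rel (x - y).
Proof.
split; first by move=> /eqP; rewrite -Quotient.idealrBE => /tens_predP.
by move=> /tens_predP h; apply/eqP; rewrite -Quotient.idealrBE.
Qed.

Fact tens_pi_is_additive : zmod_morphism tens_pi.
Proof. by move=> x y; rewrite /tens_pi (raddfB (\pi_(tens_quot))%qT). Qed.
HB.instance Definition _ :=
  GRing.isZmodMorphism.Build {malg A[V]} tensor tens_pi tens_pi_is_additive.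

Definition formal_scale (a : A) (x : {malg A[V]}) : {malg A[V]} :=
  [malg v in msupp x => a * x@_v].

Lemma formal_scaleE a x v : (formal_scale a x)@_v = a * x@_v.
Proof. by rewrite mcoeffE; case: msuppP => //; rewrite mulr0. Qed.

Lemma formal_scaleU a b v : formal_scale a << b *g v >> = << a * b *g v >>.
Proof. by apply/malgP=> w; rewrite formal_scaleE !mcoeffU mulrnAr. Qed.

Fact formal_scaleB a : zmod_morphism (formal_scale a).
Proof. by move=> x y; apply/malgP=> v; rewrite mcoeffB !formal_scaleE mcoeffB mulrBr. Qed.
HB.instance Definition _ a :=
  GRing.isZmodMorphism.Build {malg A[V]} {malg A[V]} (formal_scale a) (formal_scaleB a).

Lemma formal_scale_rel a x : tens_rel x -> tens_rel (formal_scale a x).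
Proof.
elim=> [|u v _ hu _ hv|b v w|b c v]; first by rewrite raddf0; exact: tens_rel0.
- by rewrite raddfB; exact: tens_relB.
- by rewrite !raddfB /= !formal_scaleU; exact: tens_relD.
by rewrite !raddfB /= !formal_scaleU mulrA; exact: tens_relM.
Qed.

Definition tens_scale (a : A) (t : tensor) : tensor :=
  tens_pi (formal_scale a (tens_repr t)).

Lemma tens_scaleE a x : tens_scale a (tens_pi x) = tens_pi (formal_scale a x).
Proof.
apply/tens_pi_eq; rewrite -raddfB; apply/formal_scale_rel/tens_pi_eq.
exact: tens_reprK.
Qed.

Fact tens_scaleA a b t : tens_scale a (tens_scale b t) = tens_scale (a * b) t.
Proof.
rewrite -[t]tens_reprK !tens_scaleE; congr tens_pi.
by apply/malgP=> v; rewrite !formal_scaleE mulrA.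
Qed.
Fact tens_scale1 : left_id 1 tens_scale.
Proof.
move=> t; rewrite -[t]tens_reprK tens_scaleE; congr tens_pi.
by apply/malgP=> v; rewrite formal_scaleE mul1r.
Qed.
Fact tens_scaleDr : right_distributive tens_scale +%R.
Proof.
move=> a s t; rewrite -[s]tens_reprK -[t]tens_reprK -raddfD !tens_scaleE.
by rewrite !raddfD.
Qed.
Fact tens_scaleDl t : {morph tens_scale^~ t : a b / a + b}.
Proof.
move=> a b; rewrite -[t]tens_reprK !tens_scaleE -raddfD; congr tens_pi.
by apply/malgP=> v; rewrite mcoeffD !formal_scaleE mulrDl.
Qed.
HB.instance Definition _ := GRing.Zmodule_isLmodule.Build A tensor
  tens_scaleA tens_scale1 tens_scaleDr tens_scaleDl.

Definition tens (a : A) (v : V) : tensor := tens_pi << a *g v >>.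
End Tensor.

(* Z/2-gradings of modules; degrees are booleans, added by (+). hA is the grading
   of the ring. *)
Section GradedModules.
Variables (A : pzRingType) (hA : bool -> A -> Prop).

Definition is_grading (V : lmodType A) (gV : bool -> V -> Prop) : Prop :=
  [/\ forall k, gV k 0 /\ (forall x y, gV k x -> gV k y -> gV k (x - y)),
      forall i j a x, hA i a -> gV j x -> gV (i (+) j) (a *: x),
      forall x, exists x0 x1, [/\ gV false x0, gV true x1 & x = x0 + x1] &
      forall x, gV false x -> gV true x -> x = 0].

Definition graded_submodule (V : lmodType A) (gV : bool -> V -> Prop)
    (W : V -> Prop) : Prop :=
  [/\ W 0, forall x y, W x -> W y -> W (x - y),
      forall a x, W x -> W (a *: x) &
      forall x0 x1, gV false x0 -> gV true x1 -> W (x0 + x1) -> W x0 /\ W x1].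

Definition graded_simple (V : lmodType A) (gV : bool -> V -> Prop) : Prop :=
  [/\ is_grading gV, exists x : V, x != 0 &
      forall W, graded_submodule gV W ->
        (exists x, W x /\ x != 0) -> forall x, W x].

Definition graded_iso (V W : lmodType A) (gV : bool -> V -> Prop)
    (gW : bool -> W -> Prop) : Prop :=
  exists f : {linear V -> W},
    bijective f /\ forall k x, gV k x <-> gW k (f x).

Inductive tens_hom (B : pzRingType) (f : {rmorphism B -> A}) (V : lmodType B)
    (gV : bool -> V -> Prop) : bool -> tensor f V -> Prop :=
| tens_hom_pure i j a v :
    hA i a -> gV j v -> tens_hom gV (i (+) j) (tens f a v)
| tens_homD k s t :
    tens_hom gV k s -> tens_hom gV k t -> tens_hom gV k (s + t).
End GradedModules.

(* V has dimension d over F, where F acts through eta. *)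
Definition has_dim (F : fieldType) (A : pzRingType) (eta : F -> A)
    (V : lmodType A) (d : nat) : Prop :=
  exists b : 'I_d -> V,
    forall x, exists! c : {ffun 'I_d -> F}, x = \sum_i eta (c i) *: b i.

Section GL.
Variables (F : fieldType) (m n : nat).
Local Notation gl := 'M[F]_(m + n).
Local Notation e i j := (delta_mx i j : gl).

Definition idx_odd (i : 'I_(m + n)) : bool := (m <= i)%N.
Definition root_odd (r : 'I_(m + n) * 'I_(m + n)) : bool :=
  idx_odd r.1 (+) idx_odd r.2.

Definition part (k : bool) (x : gl) : gl :=
  \matrix_(i, j) (if root_odd (i, j) == k then x i j else 0).

Definition homog (k : bool) (x : gl) : bool := part k x == x.

(* The superbracket x y - (-1)^{|x||y|} y x, extended bilinearly. *)
Definition sbr (x y : gl) : gl :=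
  \sum_(k : bool) \sum_(l : bool)
    (part k x *m part l y - (-1) ^+ (k && l) *: (part l y *m part k x)).

Definition brvs (U V : {vspace gl}) : {vspace gl} :=
  <<[seq sbr x y | x <- vbasis U, y <- vbasis V]>>%VS.

Fact part_linear k : linear (part k).
Proof.
move=> a x y; apply/matrixP=> i j; rewrite !mxE.
by case: ifP => // _; rewrite mulr0 addr0.
Qed.
HB.instance Definition _ k :=
  GRing.isLinear.Build F gl gl _ (part k) (part_linear k).

Lemma sbr_linearl y : linear (sbr^~ y).
Proof.
move=> a x x'; rewrite /sbr scaler_sumr -big_split; apply: eq_bigr => k _ /=.
rewrite scaler_sumr -big_split; apply: eq_bigr => l _ /=.
rewrite linearP mulmxDl mulmxDr -scalemxAl -scalemxAr scalerBr scalerDr opprD.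
by rewrite !scalerA mulrC addrACA.
Qed.

Fact sbr_linearr x : linear (sbr x).
Proof.
move=> a y y'; rewrite /sbr scaler_sumr -big_split; apply: eq_bigr => k _ /=.
rewrite scaler_sumr -big_split; apply: eq_bigr => l _ /=.
rewrite linearP mulmxDl mulmxDr -scalemxAl -scalemxAr scalerBr scalerDr opprD.
by rewrite !scalerA mulrC addrACA.
Qed.
HB.instance Definition _ x := GRing.isLinear.Build F gl gl _ (sbr x) (sbr_linearr x).

Section Envelopes.
Variables (p : nat) (chi : {scalar gl}) (L : {vspace gl}).

(* The free associative F-algebra on the set L; U(L) is its quotient by the
   relations that make the generators linear and compatible with the bracket. *)
Definition freealg := {malg F[{fmonom (subvs_of L)}]}.
Definition fgen (x : subvs_of L) : freealg := << fmu x >>.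

Inductive U_rel : freealg -> Prop :=
| U_rel_lin a x y : U_rel (fgen (a *: x + y) - (a *: fgen x + fgen y))
| U_rel_br i j x y z :
    homog i (vsval x) -> homog j (vsval y) -> vsval z = sbr (vsval x) (vsval y) ->
    U_rel (fgen x * fgen y - (-1) ^+ (i && j) * (fgen y * fgen x) - fgen z).

Definition U := ringquot U_rel.
Definition Ugen (x : subvs_of L) : U := rq U_rel (fgen x).
Definition Ucst (c : F) : U := rq U_rel (c%:A).

(* x ^+ p is the p-mapping x^[p] of gl_0. *)
Inductive u_rel : U -> Prop :=
| u_rel_p x y :
    homog false (vsval x) -> vsval y = vsval x ^+ p ->
    u_rel (Ugen x ^+ p - Ugen y - Ucst (chi (vsval x) ^+ p)).

Definition u := ringquot u_rel.
Definition ugen (x : subvs_of L) : u := rq u_rel (Ugen x).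
Definition ucst (c : F) : u := rq u_rel (Ucst c).

Inductive u_hom : bool -> u -> Prop :=
| u_hom_cst c : u_hom false (ucst c)
| u_hom_gen k x : homog k (vsval x) -> u_hom k (ugen x)
| u_homD k a b : u_hom k a -> u_hom k b -> u_hom k (a + b)
| u_homM i j a b : u_hom i a -> u_hom j b -> u_hom (i (+) j) (a * b).
End Envelopes.

(* The homomorphism u(L, chi) -> u(gl(m|n), chi) induced by the inclusion of L. *)
Section Restriction.
Variables (p : nat) (chi : {scalar gl}) (L : {vspace gl}).

Definition incl (x : subvs_of L) : subvs_of (fullv : {vspace gl}) :=
  vsproj fullv (vsval x).

Lemma inclK x : vsval (incl x) = vsval x.
Proof. by rewrite vsprojK ?memvf. Qed.

Fact incl_linear : linear incl.
Proof. by move=> a x y; rewrite /incl !linearP. Qed.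
HB.instance Definition _ := GRing.isLinear.Build F _ _ _ incl incl_linear.

Definition word_incl (w : {fmonom (subvs_of L)}) : freealg fullv :=
  \prod_(x <- (w : seq _)) fgen (incl x).

Fact word_incl_mmorphism : mmorphism word_incl.
Proof.
split=> [v w|]; last by rewrite /word_incl fm1 big_nil.
by rewrite /word_incl fmM big_cat.
Qed.
HB.instance Definition _ := isMultiplicative.Build _ _ word_incl word_incl_mmorphism.

Definition free_incl : freealg L -> freealg fullv := mmap (@malgC _ F) word_incl.

Lemma malgC_central (K : monomType) (c : F) (x : {malg F[K]}) :
  GRing.comm (malgC c) x.
Proof.
rewrite /GRing.comm !malgM_def fgmulUg fgmulgU; apply: eq_bigr => k _.
by rewrite mul1m mulm1 mulrC.
Qed.

Fact free_incl_monoid_morphism : monoid_morphism free_incl.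
Proof.
have [h1 h2] : GRing.multiplicative free_incl; last by split.
by apply: commr_mmap_is_multiplicative => x v w; exact: malgC_central.
Qed.
HB.instance Definition _ := GRing.Additive.on free_incl.
HB.instance Definition _ := GRing.isMonoidMorphism.Build (freealg L) (freealg fullv)
  free_incl free_incl_monoid_morphism.

Lemma free_inclZ c x : free_incl (c *: x) = c *: free_incl x.
Proof. by rewrite /free_incl mmapZ mul_malgC. Qed.

Lemma free_incl_gen x : free_incl (fgen x) = fgen (incl x).
Proof.
rewrite /free_incl /fgen mmapU.
transitivity (1 * word_incl (fmu x)); first by congr (_ * _); exact: mpolyC1E.
by rewrite mul1r /word_incl fmU big_seq1.
Qed.

Definition U_incl0 := rq (@U_rel fullv) \o free_incl.
HB.instance Definition _ := GRing.RMorphism.on U_incl0.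

Fact U_incl0_rel x : @U_rel L x -> U_incl0 x = 0.
Proof.
move=> hx; rewrite /U_incl0 /= -(raddf0 (rq (@U_rel fullv))); apply/rq_eq.
rewrite subr0; apply/ideal_genS; case: hx => [a y z|i j y z t hy hz ht].
  rewrite rmorphB rmorphD /= free_inclZ !free_incl_gen linearP.
  exact: U_rel_lin.
rewrite !rmorphB !rmorphM rmorph_sign /= !free_incl_gen.
by apply: U_rel_br; rewrite !inclK.
Qed.

Definition U_incl : U L -> U fullv := rq_lift U_incl0_rel.
HB.instance Definition _ := GRing.RMorphism.on U_incl.

Lemma U_incl_gen x : U_incl (Ugen x) = Ugen (incl x).
Proof. by rewrite /U_incl rq_liftE /= /U_incl0 /= free_incl_gen. Qed.

Lemma U_incl_cst c : U_incl (Ucst L c) = Ucst fullv c.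
Proof. by rewrite /U_incl rq_liftE /= /U_incl0 /= free_inclZ rmorph1. Qed.

Definition u_incl0 := rq (@u_rel p chi fullv) \o U_incl.
HB.instance Definition _ := GRing.RMorphism.on u_incl0.

Fact u_incl0_rel x : @u_rel p chi L x -> u_incl0 x = 0.
Proof.
move=> hx; rewrite /u_incl0 /= -(raddf0 (rq (@u_rel p chi fullv))); apply/rq_eq.
rewrite subr0; apply/ideal_genS; case: hx => y z hy hz.
rewrite !rmorphB rmorphXn /= !U_incl_gen U_incl_cst -(inclK y).
by apply: u_rel_p; rewrite !inclK.
Qed.

Definition u_incl : u p chi L -> u p chi fullv := rq_lift u_incl0_rel.
HB.instance Definition _ := GRing.RMorphism.on u_incl.

Lemma u_incl_gen x : u_incl (ugen p chi x) = ugen p chi (incl x).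
Proof. by rewrite /u_incl rq_liftE /= /u_incl0 /= U_incl_gen. Qed.
End Restriction.

Section Parabolic.
Variable chi : {scalar gl}.

(* chi_s agrees with chi on H and vanishes on root vectors. *)
Definition chis (x : gl) : F := chi (\matrix_(i, j) (if i == j then x i j else 0)).
Definition chin (x : gl) : F := chi x - chis x.

(* h_alpha for the root alpha of e i j. *)
Definition hroot (r : 'I_(m + n) * 'I_(m + n)) : gl :=
  sbr (e r.1 r.2) (e r.2 r.1).

Definition pos_root (r : 'I_(m + n) * 'I_(m + n)) : bool := (r.1 < r.2)%N.
Definition Phi' (r : 'I_(m + n) * 'I_(m + n)) : bool :=
  pos_root r && (chi (hroot r) != 0).

Definition borel : {vspace gl} :=
  (\sum_(r : 'I_(m + n) * 'I_(m + n) | (r.1 <= r.2)%N) <[e r.1 r.2]>)%VS.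

Fact chis_linear : linear_for *%R chis.
Proof.
move=> a x y; rewrite /chis -linearP; congr (chi _); apply/matrixP=> i j.
by rewrite !mxE; case: ifP => // _; rewrite mulr0 addr0.
Qed.
HB.instance Definition _ := GRing.isLinear.Build F gl F _ chis chis_linear.

Definition chis_form (x : gl) : gl := \matrix_(i, j) chis (sbr x (e i j)).

Fact chis_form_linear : linear chis_form.
Proof.
by move=> a x y; apply/matrixP=> i j; rewrite !mxE (sbr_linearl (e i j)) linearP.
Qed.
HB.instance Definition _ := GRing.isLinear.Build F gl gl _ chis_form chis_form_linear.

(* The centralizer of chi_s, see mem_levi'. *)
Definition levi' : {vspace gl} := lker (linfun chis_form).

Lemma mem_levi' x : reflect (forall y, chis (sbr x y) = 0) (x \in levi').
Proof.
rewrite memv_ker lfunE /=; apply: (iffP eqP) => [/matrixP h y|h]; last first.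
  by apply/matrixP=> i j; rewrite !mxE.
rewrite [y]matrix_sum_delta (linear_sum (sbr x)) linear_sum big1 // => i _.
rewrite (linear_sum (sbr x)) linear_sum big1 // => j _.
by have := h i j; rewrite (linearZ_LR (sbr x)) linearZ !mxE /= => ->; rewrite mulr0.
Qed.

Definition levi : {vspace gl} := brvs levi' levi'.
Definition parab : {vspace gl} := (borel + levi)%VS.

Definition nilrad : {vspace gl} :=
  (\sum_(r : 'I_(m + n) * 'I_(m + n) | Phi' r) <[e r.1 r.2]>)%VS.
Definition nil_part (k : bool) : {vspace gl} :=
  (\sum_(r : 'I_(m + n) * 'I_(m + n) | Phi' r && (root_odd r == k))
     <[e r.1 r.2]>)%VS.

Definition subalg (P : {vspace gl}) : Prop :=
  forall x y, x \in P -> y \in P -> sbr x y \in P.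

(* The nilradical of a parabolic subalgebra P with Levi factor L: a nilpotent ideal
   of P complementary to L. The largest nilpotent ideal of P is not meant: it
   also contains the scalar matrices. *)
Definition is_nilradical (P L N : {vspace gl}) : Prop :=
  [/\ forall x y, x \in P -> y \in N -> sbr x y \in N,
      exists k, iter k (brvs N) N = 0%VS,
      (L + N)%VS = P & (L :&: N)%VS = 0%VS].
End Parabolic.
End GL.

(* Main.v *)
(* With theta i = (-1)^|i| chi(e_ii), chi(h_alpha) vanishes on the root of e_ij iff
   theta i = theta j. As P is a subalgebra, the classes of theta are intervals,
   numbered increasingly by beta; then e_ij lies in P iff beta i <= beta j, and in
   the nilradical N iff beta i < beta j. The vectors of M' killed by N form a graded
   P-submodule containing the highest weight vectors, so N kills M'.

   Let f_1, ..., f_k be the root vectors of the opposite nilradical N^-. Only the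
   spanning half of PBW is needed: u(g) (x) M' is spanned by the f^I (x) m. Since M
   is simple, the theorem reduces to the independence of the f^I m in M, I ranging
   over reduced exponents and m over a basis of M'. Multiplying a relation by
   suitable powers of the f_i, deepest first, leaves f^top m = 0 with m <> 0, where
   f^top is the product of all top powers. The kernel of f^top on M' is stable under
   the Levi subalgebra, which normalizes f^top, so it would contain a highest
   weight vector v. But f^top v <> 0: up to a scalar the order of the factors does
   not matter, and one may cross the walls of the roots of N one at a time, moving v
   to a highest weight vector for each adjacent Borel subalgebra. A factor kills no
   such vector, because weights l satisfy l(h)^p - l(h) = chi(h)^p <> 0 and hence
   take no value in the prime field. *)
Require Import Defs.
From HB Require Import structures.
From mathcomp Require Import all_boot all_order all_algebra.
From mathcomp Require Import finmap boolp monalg zify ring.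

Set Implicit Arguments.
Unset Strict Implicit.
Unset Printing Implicit Defensive.

Import GRing.Theory.
Local Open Scope ring_scope.

(** * Actions of matrix units and independence of monomials *)

(** The product of all top powers is needed in two orders. Independence wants decreasing height: the
    root vector being raised must commute up to sign with those still to come, and a bracket, whose
    height is the sum of the two heights, must act as zero because deeper roots are already used up.
    Nonvanishing on a highest weight vector wants an order in which each root is simple for the
    Borel subalgebra reached so far. The two products are compared by grading monomials by total
    height: the top exponent alone has maximal weight, so any rearrangement is a multiple of the
    height-ordered product. One direction suffices: if the height-ordered product vanished on a
    vector, so would the other one. The arguments see only operators indexed by matrix units, with
    their commutation and power relations. They are stated for such families on F-spaces, with an
    index set [D] that is everything for M and for the tensor product, and the roots of the
    parabolic subalgebra for M'. Finite dimension of M' is not an assumption; it is a consequence of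
    the existence of a highest weight vector. *)

Section IterLinear.
Variables (R : pzRingType) (X : lmodType R).

Fact iter_linear (f : {linear X -> X}) k : linear (iter k f).
Proof. by move=> a x y; elim: k => //= k ->; rewrite linearP. Qed.
HB.instance Definition _ (f : {linear X -> X}) k :=
  GRing.isLinear.Build R X X _ (iter k f) (iter_linear f k).

(** The relation is asked only on [P] because root vectors commute up to sign only on vectors killed
    by deeper roots. *)
Lemma iter_scale_comm (f g : {linear X -> X}) (P : X -> Prop) (s : R) k z :
  (forall y, P y -> P (f y)) -> (forall y, P y -> f (g y) = s *: g (f y)) ->
  P z -> iter k f (g z) = s ^+ k *: g (iter k f z) /\ P (iter k f z).
Proof.
move=> Pf fg Pz; elim: k => [|k [IH Pk]] /=; first by rewrite scale1r.
by split; [rewrite IH linearZ /= fg // scalerA -exprSr|exact: Pf].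
Qed.
End IterLinear.

Section MatrixUnitActions.
Variables (F : fieldType) (N : nat) (par : 'I_N -> bool) (p : nat).
Local Notation idx := ('I_N * 'I_N)%type.
Implicit Types (r s t x : idx) (ys : seq idx).

Definition unit_odd r : bool := par r.1 (+) par r.2.
(** The power at which a root vector becomes a scalar: an odd one satisfies $2e^2=[e,e]=0$, an even
    one has $e^{[p]}=0$ and hence $e^p=\chi(e)^p$. *)
Definition unit_deg r : nat := if unit_odd r then 2 else p.
Definition unit_sgn r s : F := (-1) ^+ (unit_odd r && unit_odd s).

Lemma unit_sgn_neq0 r s : unit_sgn r s != 0.
Proof. by rewrite /unit_sgn signr_eq0. Qed.

(* The operators by which the matrix units e_r, r in D, act on a module with
   p-character chi; c r stands for chi (e_r) ^+ p. *)
Record unit_action (D : pred idx) (c : idx -> F) (X : lmodType F) := UnitAction {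
  unit_op :> idx -> {linear X -> X};
  unit_op_br : forall r s z, D r -> D s ->
    unit_op r (unit_op s z) = unit_sgn r s *: unit_op s (unit_op r z)
      + (if r.2 == s.1 then unit_op (r.1, s.2) z else 0)
      - (if s.2 == r.1 then unit_sgn r s *: unit_op (s.1, r.2) z else 0);
  unit_op_root : forall r z, D r -> r.1 != r.2 ->
    iter (unit_deg r) (unit_op r) z = c r *: z;
  unit_op_diag : forall i z, D (i, i) ->
    iter p (unit_op (i, i)) z = unit_op (i, i) z + c (i, i) *: z }.

Section Action.
Variables (D : pred idx) (c : idx -> F) (X : lmodType F).
Variable E : unit_action D c X.
Implicit Types z w : X.

Section Nilpotent.
Variables (Q : pred idx) (ht : idx -> nat).
Hypothesis QD : forall r, Q r -> D r.
Hypothesis ht_gt0 : forall r, Q r -> (0 < ht r)%N.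
Hypothesis Qadd : forall r s, Q r -> Q s -> r.2 = s.1 ->
  Q (r.1, s.2) /\ ht (r.1, s.2) = (ht r + ht s)%N.
Lemma nil_offdiag r : Q r -> r.1 != r.2.
Proof.
move=> Qr; apply/eqP=> e; have [_] := Qadd Qr Qr (esym e).
by rewrite -surjective_pairing; have := ht_gt0 Qr; lia.
Qed.

Lemma nil_op_comm r s z : Q r -> Q s ->
  (forall t, Q t -> ht t = (ht r + ht s)%N -> E t z = 0) ->
  E r (E s z) = unit_sgn r s *: E s (E r z).
Proof.
move=> Qr Qs h; rewrite (unit_op_br E) ?QD //.
have -> : (if r.2 == s.1 then E (r.1, s.2) z else 0) = 0.
  by case: eqP => // e; have [q1 q2] := Qadd Qr Qs e; rewrite h.
have -> : (if s.2 == r.1 then unit_sgn r s *: E (s.1, r.2) z else 0) = 0.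
  case: eqP => // e; have [q1 q2] := Qadd Qs Qr e.
  by rewrite h ?scaler0 // q2 addnC.
by rewrite addr0 subr0.
Qed.

(* A final segment of an enumeration of Q by decreasing height. *)
Definition ht_segment ys : Prop :=
  [/\ uniq ys, sorted (fun r s => ht s <= ht r)%N ys, {subset ys <= Q} &
      forall r t, Q r -> r \notin ys -> t \in ys -> (ht t <= ht r)%N].

Lemma ht_segment_head x ys t : ht_segment (x :: ys) -> t \in ys -> (ht t <= ht x)%N.
Proof.
case=> _ sx _ _ ty; have tr : transitive (fun r s => ht s <= ht r)%N.
  by move=> a b e h1 h2; apply: leq_trans h2 h1.
exact: (allP (order_path_min tr sx)).
Qed.

Lemma ht_segment_behead x ys : ht_segment (x :: ys) -> ht_segment ys.
Proof.
move=> h; case: (h) => /= /andP[_ uy] sx sub hi; split=> //.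
- exact: path_sorted sx.
- by move=> r ry; apply: sub; rewrite inE ry orbT.
move=> r t Qr ry ty; have [->|rx] := eqVneq r x.
  exact: ht_segment_head h ty.
by apply: hi; rewrite ?inE ?ty ?orbT // negb_or rx.
Qed.

Definition ht_enum : seq idx := sort (fun r s => ht s <= ht r)%N (enum Q).

Lemma mem_ht_enum r : (r \in ht_enum) = Q r.
Proof. by rewrite mem_sort mem_enum. Qed.

Lemma ht_segment_enum : ht_segment ht_enum.
Proof.
split.
- by rewrite sort_uniq enum_uniq.
- by apply: sort_sorted => r s; exact: leq_total.
- by move=> r; rewrite mem_ht_enum.
by move=> r t Qr; rewrite mem_ht_enum Qr.
Qed.

Definition killed_off ys z : Prop := forall r, Q r -> r \notin ys -> E r z = 0.

(** Moving [E r] past [E s] costs a root vector of height [ht r + ht s]. It is again outside [ys],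
    since nothing in [ys] is higher than [r]. *)
Lemma killed_off_op ys s z :
  ht_segment ys -> Q s -> killed_off ys z -> killed_off ys (E s z).
Proof.
case=> _ _ _ hi Qs kz r Qr ry; rewrite nil_op_comm //.
  by rewrite (kz r) // linear0 scaler0.
move=> t Qt ht_t; apply: kz => //; apply/negP=> /(hi _ _ Qr ry).
by have := ht_gt0 Qs; lia.
Qed.

Lemma killed_off_iter ys s k z :
  ht_segment ys -> Q s -> killed_off ys z -> killed_off ys (iter k (E s) z).
Proof. by move=> hy Qs kz; elim: k => //= k IH; apply: killed_off_op. Qed.

Lemma killed_off_high x ys t z : ht_segment (x :: ys) -> killed_off (x :: ys) z ->
  Q t -> (ht x < ht t)%N -> E t z = 0.
Proof.
move=> hy kz Qt lt; apply: kz => //; rewrite inE negb_or.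
apply/andP; split; first by apply/eqP=> e; rewrite e ltnn in lt.
by apply/negP=> /(ht_segment_head hy); rewrite leqNgt lt.
Qed.

Lemma killed_off_comm x ys s z : ht_segment (x :: ys) -> Q s ->
  killed_off (x :: ys) z -> E x (E s z) = unit_sgn x s *: E s (E x z).
Proof.
move=> hy Qs kz; have Qx : Q x by case: hy => _ _ sub _; apply: sub; rewrite inE eqxx.
apply: nil_op_comm => // t Qt ht_t; apply: killed_off_high hy kz Qt _.
by have := ht_gt0 Qs; lia.
Qed.

Hypothesis p_gt1 : (1 < p)%N.

Lemma unit_deg_gt1 r : (1 < unit_deg r)%N.
Proof. by rewrite /unit_deg; case: ifP. Qed.

Hypothesis cQ : forall r, Q r -> c r = 0.

Lemma nil_op_iter r k z : Q r -> (unit_deg r <= k)%N -> iter k (E r) z = 0.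
Proof.
move=> Qr le; rewrite -(subnK le) iterD unit_op_root ?QD ?nil_offdiag //.
by rewrite cQ // scale0r linear0.
Qed.

Lemma killed_off_top x ys z : ht_segment (x :: ys) -> killed_off (x :: ys) z ->
  killed_off ys (iter (unit_deg x).-1 (E x) z).
Proof.
move=> hy kz r Qr ry; have Qx : Q x by case: hy => _ _ sub _; apply: sub; rewrite inE eqxx.
have [->|rx] := eqVneq r x.
  by rewrite -iterS prednK ?nil_op_iter // ltnW ?unit_deg_gt1.
by apply: killed_off_iter hy Qx kz _ Qr _; rewrite inE negb_or rx.
Qed.

(** Engel's argument, one root at a time and deepest first: the last nonzero power of [E x] on the
    vector is killed by [E x] and remains killed by the deeper roots. *)
Lemma exists_killed (K : X -> Prop) :
  (forall r z, Q r -> K z -> K (E r z)) -> (exists z, K z /\ z != 0) ->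
  exists z, [/\ K z, z != 0 & forall r, Q r -> E r z = 0].
Proof.
move=> KE [z [Kz z0]].
have : killed_off ht_enum z by move=> r Qr; rewrite mem_ht_enum Qr.
elim: ht_enum (ht_segment_enum) z Kz z0 => [|x ys IH] hy z Kz z0 kz.
  by exists z; split=> // r Qr; apply: kz.
have Qx : Q x by case: hy => _ _ sub _; apply: sub; rewrite inE eqxx.
have ex : exists k, iter k (E x) z == 0.
  by exists (unit_deg x); rewrite nil_op_iter.
case: (ex_minnP ex) => [[|k]] /eqP h0 hmin; first by move: z0;
  rewrite -[z]/(iter 0 (E x) z) h0 eqxx.
apply: (IH (ht_segment_behead hy) (iter k (E x) z)).
- by elim: k {h0 hmin} => //= k IHk; apply: KE.
- by apply/negP=> /hmin; rewrite ltnn.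
move=> r Qr ry; have [->|rx] := eqVneq r x; first exact: h0.
by apply: killed_off_iter hy Qx kz _ Qr _; rewrite inE negb_or rx.
Qed.

(** The head of [ys] acts first, so in a height segment the deepest root stands next to the
    vector. *)
Fixpoint monomial ys (I : seq nat) : X -> X :=
  if ys is r :: ys' then
    if I is a :: I' then fun z => monomial ys' I' (iter a (E r) z) else id
  else id.

Fact monomial_linear ys I : linear (monomial ys I).
Proof.
elim: ys I => [|r ys IH] [|a I] // s z w /=.
by rewrite linearP IH.
Qed.
HB.instance Definition _ ys I :=
  GRing.isLinear.Build F X X _ (monomial ys I) (monomial_linear ys I).

Fixpoint exponents ys : seq (seq nat) :=
  if ys is r :: ys' then
    [seq a :: J | a <- iota 0 (unit_deg r), J <- exponents ys']
  else [:: [::]].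

Lemma exponents_uniq ys : uniq (exponents ys).
Proof.
elim: ys => //= x ys IH; apply: allpairs_uniq_dep => //; first exact: iota_uniq.
by move=> [a J] [b J'] _ _ /= [-> ->].
Qed.

Definition top_exponent ys : seq nat := [seq (unit_deg r).-1 | r <- ys].
Definition top_op ys : X -> X := monomial ys (top_exponent ys).
HB.instance Definition _ ys := GRing.Linear.on (top_op ys).

(** The scalar is a product of signs fixed by the exponents. Its independence of [w] is what allows
    it to be used in a relation with arbitrary coefficient vectors. *)
Lemma iter_monomial x ys us J k : ht_segment (x :: ys) -> {subset us <= Q} ->
  exists2 s : F, s != 0 & forall w, killed_off (x :: ys) w ->
    iter k (E x) (monomial us J w) = s *: monomial us J (iter k (E x) w).
Proof.
move=> hy; have [_ _ sub _] := hy.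
have Qx : Q x by apply: sub; rewrite inE eqxx.
elim: us J {sub} => [|t us IH] [|a J] sub;
  try by exists 1 => [|w _]; rewrite ?oner_eq0 ?scale1r.
have Qt : Q t by apply: sub; rewrite inE eqxx.
have [|s s0 hs] := IH J; first by move=> r ru; apply: sub; rewrite inE ru orbT.
exists (s * (unit_sgn x t ^+ k) ^+ a).
  by apply: mulf_neq0 => //; do 2!apply: expf_neq0; exact: unit_sgn_neq0.
move=> w kw /=; rewrite hs; last exact: killed_off_iter.
rewrite -scalerA; congr (_ *: _); rewrite -linearZ /=; congr (monomial _ _ _).
elim: a w kw => [|a IHa] w kw /=; first by rewrite scale1r.
have [-> _] : iter k (E x) (E t (iter a (E t) w)) =
   unit_sgn x t ^+ k *: E t (iter k (E x) (iter a (E t) w)) /\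
   killed_off (x :: ys) (iter k (E x) (iter a (E t) w)).
  apply: iter_scale_comm; last exact: killed_off_iter.
    by move=> y; apply: killed_off_op.
  by move=> y ky; apply: killed_off_comm ky.
by rewrite IHa // linearZ scalerA -exprS.
Qed.

(** Once the deepest root [x] has been brought to its top power, the relation lives on the image of
    [V] under that power. There [x] acts as zero and the next root takes its place. Since the space
    changes along the induction, [V] is general. *)
Lemma monomial_free (V : X -> Prop) ys (f : seq nat -> X) :
  V 0 -> (forall a v w, V v -> V w -> V (a *: v + w)) ->
  ht_segment ys -> (forall v, V v -> killed_off ys v) ->
  (forall v, V v -> top_op ys v = 0 -> v = 0) ->
  (forall I, V (f I)) ->
  \sum_(J <- exponents ys) monomial ys J (f J) = 0 ->
  forall I, I \in exponents ys -> f I = 0.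
Proof.
move=> V0 VP; elim: ys V V0 VP f => [|x ys IH] V V0 VP f hy kV injV Vf.
  by rewrite /= big_seq1 => h I; rewrite inE => /eqP ->.
have Qx : Q x by case: hy => _ _ sub _; apply: sub; rewrite inE eqxx.
have d_gt1 := unit_deg_gt1 x.
rewrite /= big_allpairs_dep /= => sum0.
suff fa0 a : (a < unit_deg x)%N -> forall I, I \in exponents ys -> f (a :: I) = 0.
  move=> I /allpairsPdep[a [J [ha hJ ->]]]; apply: fa0 => //.
  by move: ha; rewrite mem_iota.
elim/ltn_ind: a => a IHa a_lt.
(* Exponents below [a] are settled by induction; this power of [E x] makes every exponent above [a]
   overflow and brings [a] to the top. *)
pose k := ((unit_deg x).-1 - a)%N.
have hs I : {s : F | s != 0 & forall w, killed_off (x :: ys) w ->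
    iter k (E x) (monomial ys I w) = s *: monomial ys I (iter k (E x) w)}.
  apply: boolp.cid2; apply: iter_monomial => // r ry.
  by case: hy => _ _ sub _; apply: sub; rewrite inE ry orbT.
pose s I := s2val (hs I).
pose V' z := exists2 v, V v & z = iter (unit_deg x).-1 (E x) v.
have : \sum_(J <- exponents ys)
    monomial ys J (s J *: iter (unit_deg x).-1 (E x) (f (a :: J))) = 0.
  have := congr1 (iter k (E x)) sum0; rewrite linear0 linear_sum /=.
  rewrite (bigD1_seq a) ?iota_uniq ?mem_iota //= [X in _ + X]big1_seq ?addr0; last first.
    move=> b /andP[ba]; rewrite mem_iota add0n /= => b_lt.
    rewrite linear_sum big1_seq //= => I hI.
    have [b_lt_a|] := ltnP b a; first by rewrite IHa // !linear0.
    rewrite leq_eqVlt eq_sym (negPf ba) /= => a_lt_b.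
    case: (hs I) => t _ ->; last by apply: killed_off_iter => //; exact: kV.
    by rewrite -iterD nil_op_iter ?linear0 ?scaler0 // /k; lia.
  move=> e; rewrite -[RHS]e linear_sum; apply: eq_bigr => I _.
  rewrite linearZ /= (s2valP' (hs I)); last by apply: killed_off_iter => //; exact: kV.
  by rewrite -iterD /k subnK //; lia.
move/(IH V') => h I hI.
have : s I *: iter (unit_deg x).-1 (E x) (f (a :: I)) = 0.
  apply: h => //.
  - by exists 0 => //; rewrite linear0.
  - move=> b v w [v1 Vv ->] [w1 Vw ->].
    by exists (b *: v1 + w1); [exact: VP|rewrite linearP].
  - exact: ht_segment_behead hy.
  - by move=> v [w Vw ->]; apply: killed_off_top; last exact: kV.
  - by move=> v [w Vw ->] h; rewrite (injV w) // linear0.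
  - move=> J; exists (s J *: f (a :: J)); last by rewrite linearZ.
    by rewrite -[_ *: _]addr0; apply: VP.
move/eqP; rewrite scaler_eq0 (negPf (s2valP (hs I))) /= => /eqP h0.
by apply: injV => //; rewrite /top_op /= h0 linear0.
Qed.

(** Up to sign [E s] moves to its own factor of the product, where the power overflows and becomes
    [c s], which is 0. *)
Lemma top_op_kill ys s z : ht_segment ys -> s \in ys ->
  (forall t, Q t -> (ht s < ht t)%N -> E t z = 0) -> top_op ys (E s z) = 0.
Proof.
elim: ys z => // t ys IH z hy; rewrite inE /top_op /=.
have [_ _ sub _] := hy; have Qt : Q t by apply: sub; rewrite inE eqxx.
have [-> _ _|st /= sy kz] := eqVneq s t.
  rewrite -iterSr prednK; last by rewrite ltnW ?unit_deg_gt1.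
  by rewrite nil_op_iter // linear0.
have Qs : Q s by apply: sub; rewrite inE sy orbT.
pose P y := forall u, Q u -> (ht s < ht u)%N -> E u y = 0.
have [|||-> Pz] := @iter_scale_comm _ _ (E t) (E s) P (unit_sgn t s)
    (unit_deg t).-1 z.
- move=> y Py u Qu hu; rewrite nil_op_comm // ?Py ?linear0 ?scaler0 //.
  by move=> v Qv hv; apply: Py => //; lia.
- move=> y Py; apply: nil_op_comm => // v Qv hv; apply: Py => //.
  by have := ht_gt0 Qt; lia.
- exact: kz.
rewrite linearZ /=; have := IH _ (ht_segment_behead hy) sy Pz; rewrite /top_op => ->.

by rewrite scaler0.
Qed.

(** Moving [E q] through the product replaces one factor [E x] by a root vector [E s] of the same
    height. If [s] is [x], the product applied to [z] reappears; if [s] lies in [ys], its power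
    overflows; otherwise [E s] acts as zero. *)
Lemma top_op_normalized q ys z : D q ->
  (forall s, Q s -> q.2 = s.1 -> Q (q.1, s.2) /\ ht (q.1, s.2) = ht s) ->
  (forall s, Q s -> s.2 = q.1 -> Q (s.1, q.2) /\ ht (s.1, q.2) = ht s) ->
  ht_segment ys -> killed_off ys z -> top_op ys z = 0 -> top_op ys (E q z) = 0.
Proof.
move=> Dq hl hr; elim: ys z => [|x ys IH] z hy kz.
  by rewrite /top_op /= => ->; rewrite linear0.
have [_ _ sub _] := hy; have Qx : Q x by apply: sub; rewrite inE eqxx.
have d_gt1 := unit_deg_gt1 x; set d := (unit_deg x).-1.
rewrite /top_op /= -/(top_op ys) -/d => T0.
suff h a b : (a + b = d)%N ->
    top_op ys (iter a (E x) (E q (iter b (E x) z))) = 0.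
  by have := h d 0; rewrite addn0 /top_op /=; apply.
elim: a b => [|a IHa] b ab.
  rewrite /= -ab add0n in T0 *; apply: IH => //; first exact: ht_segment_behead hy.
  by rewrite -[b]add0n ab; exact: killed_off_top.
have kb k : killed_off (x :: ys) (iter k (E x) z) by exact: killed_off_iter.
have T1 s : Q s -> ht s = ht x ->
    top_op ys (iter a (E x) (E s (iter b (E x) z))) = 0.
  move=> Qs hs.
  have [|||-> _] := @iter_scale_comm _ _ (E x) (E s) (killed_off (x :: ys))
      (unit_sgn x s) a (iter b (E x) z).
  - by move=> y; apply: killed_off_op.
  - by move=> y; apply: killed_off_comm.
  - exact: kb.
  rewrite -iterD linearZ /=.
  have [->|sx] := eqVneq s x; first by rewrite -iterS -addSn ab T0 scaler0.
  have [sy|sy] := boolP (s \in ys); last first.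
    by rewrite kb ?linear0 ?scaler0 // inE negb_or sx.
  rewrite top_op_kill ?scaler0 //; first exact: ht_segment_behead hy.
  move=> t Qt lt; apply: killed_off_high hy _ Qt _; first exact: kb.
  by rewrite -hs.
rewrite iterSr (unit_op_br E _ (QD Qx) Dq) !linearB !linearD /= !linearZ /=.
rewrite -iterS IHa ?scaler0 ?add0r; last by rewrite addnS -addSn.
have -> : top_op ys (iter a (E x) (if x.2 == q.1 then E (x.1, q.2)
    (iter b (E x) z) else 0)) = 0.
  by case: eqP => [/(hr _ Qx)[q1 q2]|_]; [exact: T1|rewrite !linear0].
rewrite add0r; case: eqP => [/(hl _ Qx)[q1 q2]|_]; last by rewrite !linear0 ?subr0 ?oppr0.
by rewrite !linearZ /= T1 // linear0 scaler0.
Qed.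

End Nilpotent.
End Action.
End MatrixUnitActions.

(** * Spanning by monomials *)

Section Spanning.
Variables (F : fieldType) (N : nat) (par : 'I_N -> bool) (p : nat).
Local Notation idx := ('I_N * 'I_N)%type.
Implicit Types (r s t x : idx) (ys : seq idx).
Variables (D : pred idx) (c : idx -> F) (X : lmodType F).
Variable E : unit_action par p D c X.
Implicit Types z w y : X.
Local Notation unit_deg := (unit_deg par p).

Definition subspace (Y : X -> Prop) : Prop :=
  Y 0 /\ forall a y z, Y y -> Y z -> Y (a *: y + z).

Lemma subspaceZ Y a z : subspace Y -> Y z -> Y (a *: z).
Proof. by case=> Y0 YP Yz; rewrite -[_ *: _]addr0; apply: YP. Qed.

Lemma subspaceD Y y z : subspace Y -> Y y -> Y z -> Y (y + z).
Proof. by case=> Y0 YP Yy Yz; rewrite -[y]scale1r; apply: YP. Qed.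

Lemma subspaceB Y y z : subspace Y -> Y y -> Y z -> Y (y - z).
Proof. by case=> Y0 YP Yy Yz; rewrite addrC -scaleN1r; apply: YP. Qed.

Section Layers.
Variables (Q : pred idx) (ht : idx -> nat) (gr : idx -> nat).
Hypothesis QD : forall r, Q r -> D r.
Hypothesis ht_gt0 : forall r, Q r -> (0 < ht r)%N.
Hypothesis Qadd : forall r s, Q r -> Q s -> r.2 = s.1 ->
  Q (r.1, s.2) /\ ht (r.1, s.2) = (ht r + ht s)%N.
Hypothesis Qgr : forall r s, Q r -> Q s -> r.2 = s.1 ->
  gr (r.1, s.2) = (gr r + gr s)%N.

(** The degree counts the roots applied, with weights [gr]. The zero weight gives plain spanning;
    the height as weight isolates the top monomial. *)
Inductive layer x (Y : nat -> X -> Prop) : nat -> X -> Prop :=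
| layer0 k : layer x Y k 0
| layerP k a v w : layer x Y k v -> layer x Y k w -> layer x Y k (a *: v + w)
| layer_in k a y : (a < unit_deg x)%N -> Y k y ->
    layer x Y (k + a * gr x) (iter a (E x) y).

Fixpoint layers ys (Y : nat -> X -> Prop) : nat -> X -> Prop :=
  if ys is x :: ys' then layers ys' (layer x Y) else Y.

Fixpoint weight ys (J : seq nat) : nat :=
  if ys is r :: ys' then
    if J is a :: J' then (weight ys' J' + a * gr r)%N else 0%N
  else 0%N.

Lemma layers_ind ys Y (P : nat -> X -> Prop) :
  (forall k, subspace (P k)) ->
  (forall J k y, J \in exponents par p ys -> Y k y ->
     P (k + weight ys J)%N (monomial E ys J y)) ->
  forall k z, layers ys Y k z -> P k z.
Proof.
elim: ys Y => [|x ys IH] Y sP h k z /=.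
  by move=> Yz; have := h [::] k z isT Yz; rewrite addn0.
apply: IH => // J l y hJ; elim=> {l y} [l|l a v w _ Pv _ Pw|l a y a_lt Yy].
- by rewrite linear0; case: (sP (l + weight ys J)%N).
- by rewrite linearP; case: (sP (l + weight ys J)%N) => _; apply.
have := h (a :: J) l y _ Yy; rewrite /= -addnA [(a * _ + _)%N]addnC; apply.
by apply/allpairsPdep; exists a, J; rewrite mem_iota.
Qed.

(** Replacing an overflowing power of [E r] by the scalar [c r] drops the exponent but not the
    degree, so the family has to absorb the shift. *)
Definition power_stable (Y : nat -> X -> Prop) : Prop :=
  forall r k y, Q r -> Y k y -> Y (k + unit_deg r * gr r)%N (c r *: y).

Definition stable_off ys (Y : nat -> X -> Prop) : Prop :=
  forall r k y, Q r -> r \notin ys -> Y k y -> Y (k + gr r)%N (E r y).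

Lemma layer_subspace x Y k : subspace (layer x Y k).
Proof. by split; [exact: layer0|move=> a y z; exact: layerP]. Qed.

Lemma layer_power x Y : power_stable Y -> power_stable (layer x Y).
Proof.
move=> pY r k y Qr; elim=> {k y} [k|k a v w _ hv _ hw|k a y a_lt Yy].
- by rewrite scaler0; exact: layer0.
- rewrite scalerDr scalerA mulrC -scalerA; exact: layerP.
rewrite -linearZ addnAC; apply: layer_in => //; exact: pY.
Qed.

Lemma sub_layer x Y k y : (1 < p)%N -> Y k y -> layer x Y k y.
Proof.
move=> p_gt1 Yy; have := @layer_in x Y k 0 y; rewrite mul0n addn0; apply=> //.
by rewrite ltnW ?unit_deg_gt1.
Qed.

Lemma sub_layers ys Y k y : (1 < p)%N -> Y k y -> layers ys Y k y.
Proof.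
by move=> p_gt1; elim: ys Y => //= x ys IH Y Yy; apply: IH; apply: sub_layer.
Qed.

Lemma layers_subspace ys Y k :
  (forall k, subspace (Y k)) -> subspace (layers ys Y k).
Proof.
by elim: ys Y => //= x ys IH Y sY; apply: IH => l; exact: layer_subspace.
Qed.

Lemma layer_iter x Y a k y : (1 < p)%N -> Q x -> power_stable Y -> Y k y ->
  layer x Y (k + a * gr x) (iter a (E x) y).
Proof.
move=> p_gt1 Qx pY; elim/ltn_ind: a k y => a IH k y Yy.
have [a_lt|a_ge] := ltnP a (unit_deg x); first exact: layer_in.
rewrite -(subnK a_ge) iterD (unit_op_root E) ?QD //; last first.
  exact: (nil_offdiag ht_gt0 Qadd Qx).
rewrite mulnDl [((a - _) * _ + _)%N]addnC addnA; apply: IH; last exact: pY.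
by have := unit_deg_gt1 par p_gt1 x; lia.
Qed.

Lemma layer_op x Y k y : (1 < p)%N -> Q x -> power_stable Y ->
  layer x Y k y -> layer x Y (k + gr x) (E x y).
Proof.
move=> p_gt1 Qx pY; elim=> {k y} [k|k a v w _ hv _ hw|k a y a_lt Yy].
- by rewrite linear0; exact: layer0.
- by rewrite linearP; exact: layerP.
by rewrite -iterS -addnA -mulSnr; exact: layer_iter.
Qed.

(** The straightening step of PBW. When [E r] passes powers of [E x], the brackets have height
    [ht r + ht x], too large to lie in [x :: ys]; they are treated by the same induction on the
    exponent, so [r] stays general in it. *)
Lemma layer_stable x ys Y : (1 < p)%N -> ht_segment Q ht (x :: ys) ->
  power_stable Y -> stable_off (x :: ys) Y -> stable_off ys (layer x Y).
Proof.
move=> p_gt1 hy pY sY r k y Qr ry.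
have Qx : Q x by case: hy => _ _ sub _; apply: sub; rewrite inE eqxx.
have [->|rx] := eqVneq r x; first exact: layer_op.
have {ry}rx : r \notin x :: ys by rewrite inE negb_or rx.
elim=> {k y} [k|k a v w _ hv _ hw|k a y _ Yy].
- by rewrite linear0; exact: layer0.
- by rewrite linearP; exact: layerP.
elim: a r Qr rx => [|a IH] r Qr rx.
  by rewrite mul0n addn0; apply: sub_layer => //; exact: sY.
have sL := layer_subspace x Y.
have hi t : Q t -> ht t = (ht r + ht x)%N -> t \notin x :: ys.
  move=> Qt e; apply/negP=> tx; case: hy => _ _ _ /(_ r t Qr rx tx).
  by rewrite e; have := ht_gt0 Qx; lia.
have -> : (k + a.+1 * gr x + gr r = k + a * gr x + gr r + gr x)%N.
  by rewrite mulSnr; lia.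
rewrite /= (unit_op_br E) ?QD //.
apply: subspaceB => //; first apply: subspaceD => //.
- by apply: subspaceZ => //; apply: layer_op => //; exact: IH.
- case: eqP => [e|_]; last by case: (sL (k + a * gr x + gr r + gr x)%N).
  have [q1 q2] := Qadd Qr Qx e; have := IH _ q1 (hi _ q1 q2).
  by rewrite (Qgr Qr Qx e) addnA.
case: eqP => [e|_]; last by case: (sL (k + a * gr x + gr r + gr x)%N).
apply: subspaceZ => //.
have [q1 q2] := Qadd Qx Qr e; rewrite addnC in q2; have := IH _ q1 (hi _ q1 q2).
by rewrite (Qgr Qx Qr e) addnA addnAC.
Qed.

Lemma layers_stable ys Y : (1 < p)%N -> ht_segment Q ht ys ->
  power_stable Y -> stable_off ys Y -> stable_off [::] (layers ys Y).
Proof.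
move=> p_gt1; elim: ys Y => //= x ys IH Y hy pY sY.
apply: IH; [exact: ht_segment_behead hy|exact: layer_power|exact: layer_stable].
Qed.

Lemma layers_enum_stable Y : (1 < p)%N -> power_stable Y ->
  stable_off [::] (layers (ht_enum Q ht) Y).
Proof.
move=> p_gt1 pY; apply: layers_stable => //; first exact: ht_segment_enum.
by move=> r k y Qr; rewrite mem_ht_enum Qr.
Qed.

End Layers.

Section Generation.
Variables (Q : pred idx) (ht : idx -> nat).
Hypothesis QD : forall r, Q r -> D r.
Hypothesis ht_gt0 : forall r, Q r -> (0 < ht r)%N.
Hypothesis Qadd : forall r s, Q r -> Q s -> r.2 = s.1 ->
  Q (r.1, s.2) /\ ht (r.1, s.2) = (ht r + ht s)%N.
Hypothesis p_gt1 : (1 < p)%N.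

Inductive generated (Y : X -> Prop) : X -> Prop :=
| generated_in y : Y y -> generated Y y
| generated0 : generated Y 0
| generatedP a v w : generated Y v -> generated Y w -> generated Y (a *: v + w)
| generatedM r z : Q r -> generated Y z -> generated Y (E r z).

(** Operators of [D] outside [Q] need only preserve [Y]: passing one through a generator leaves
    brackets that are again in [D]. *)
Lemma generated_stable Y q z :
  (forall i j k, D (i, j) -> D (j, k) -> D (i, k)) ->
  (forall r y, D r -> ~~ Q r -> Y y -> Y (E r y)) ->
  D q -> generated Y z -> generated Y (E q z).
Proof.
move=> Dtr YE Dq gz.
have sG : subspace (generated Y).
  by split; [exact: generated0|move=> a y w; exact: generatedP].
elim: gz q Dq => {z} [y Yy||a v w _ hv _ hw|r z Qr gz IH] q Dq.
- have [Qq|nQ] := boolP (Q q); last by apply: generated_in; apply: YE.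
  by apply: generatedM => //; exact: generated_in.
- by rewrite linear0; exact: generated0.
- by rewrite linearP; apply: generatedP; auto.
move: (QD Qr) => Dr; rewrite (unit_op_br E) //.
case: q r Dq Dr Qr gz => [i j] [k l] /= Dq Dr Qr gz.
apply: subspaceB => //; first apply: subspaceD => //.
- by apply: subspaceZ => //; apply: generatedM => //; apply: IH.
- by case: eqP => [e|_]; [subst k; apply: IH; apply: Dtr Dr|exact: generated0].
case: eqP => [e|_]; last exact: generated0.
by subst l; apply: subspaceZ => //; apply: IH; apply: Dtr Dq.
Qed.

Lemma generated_monomials Y z : subspace Y -> generated Y z ->
  exists f : seq nat -> X, (forall J, Y (f J)) /\
    z = \sum_(J <- exponents par p (ht_enum Q ht))
          monomial E (ht_enum Q ht) J (f J).
Proof.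
(* With zero weights everything sits in degree 0, and [power_stable] follows from [Y] being a
   subspace. *)
move=> sY gz; pose gr r : nat := 0; set ys := ht_enum Q ht.
have {gz} lz : layers gr ys (fun=> Y) 0 z.
  have pY : power_stable Q gr (fun=> Y) by move=> r k y _ Yy; exact: subspaceZ.
  have st := @layers_enum_stable Q ht gr QD ht_gt0 Qadd (fun _ _ _ _ _ => erefl) _ p_gt1 pY.
  have sL := @layers_subspace gr ys (fun=> Y) 0 (fun=> sY).
  elim: gz => {z} [y Yy||a v w _ hv _ hw|r z Qr _ hz].
  - exact: sub_layers.
  - by case: sL.
  - by case: sL => _; apply.
  - by have := st r 0%N z Qr isT hz.
pose P (k : nat) z := exists f : seq nat -> X, (forall J, Y (f J)) /\
    z = \sum_(J <- exponents par p ys) monomial E ys J (f J).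
apply: (@layers_ind gr ys (fun=> Y) P _ _ 0%N z lz) => [k|J k y hJ Yy].
  split=> [|a _ _ [f [Yf ->]] [g [Yg ->]]].
    exists (fun=> 0); split; first by case: sY.
    by rewrite big1 // => J _; rewrite linear0.
  exists (fun J => a *: f J + g J); split; first by move=> J; case: sY => _; apply.
  rewrite scaler_sumr -big_split /=; apply: eq_bigr => J _.
  by rewrite linearP.
exists (fun J' => if J' == J then y else 0); split.
  by move=> J'; case: ifP => _ //; case: sY.
rewrite (bigD1_seq J) ?exponents_uniq //= eqxx big1_seq ?addr0 // => J' /andP[/negPf -> _].
by rewrite linear0.
Qed.

(** No exponent exceeds the top one and heights are positive, so any smaller exponent strictly
    lowers the weight. *)
Lemma weight_top (ys : seq idx) J : {subset ys <= Q} ->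
  J \in exponents par p ys -> weight ht ys J = weight ht ys (top_exponent par p ys) ->
  J = top_exponent par p ys.
Proof.
move=> sub hJ.
suff: (weight ht ys J <= weight ht ys (top_exponent par p ys))%N /\
  (weight ht ys J = weight ht ys (top_exponent par p ys) ->
  J = top_exponent par p ys) by case.
elim: ys J sub hJ => [|x ys IH] J sub /=; first by rewrite inE => /eqP ->.
case/allpairsPdep=> a [J' [+ hJ' ->]]; rewrite mem_iota add0n /= => a_lt.
have Qx : Q x by apply: sub; rewrite inE eqxx.
have [|le eq] := IH J' _ hJ'; first by move=> r ry; apply: sub; rewrite inE ry orbT.
have le2 : (a * ht x <= (unit_deg x).-1 * ht x)%N.
  by rewrite leq_mul2r -ltnS prednK ?a_lt ?orbT // ltnW ?unit_deg_gt1.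
split; first exact: leq_add.
move=> e; have e1 : (a * ht x = (unit_deg x).-1 * ht x)%N by lia.
have -> : a = (unit_deg x).-1.
  by apply/eqP; move/eqP: e1; rewrite eqn_pmul2r ?ht_gt0.
by rewrite eq //; lia.
Qed.

(* The component of maximal weight of the span of the monomials is the line of
   the top monomial, so the order of the factors matters only up to a scalar. *)
Lemma top_op_perm ys v : (forall r, Q r -> c r = 0) -> perm_eq ys (ht_enum Q ht) ->
  exists a, top_op E ys v = a *: top_op E (ht_enum Q ht) v.
Proof.
move=> cQ hp; set qs := ht_enum Q ht.
(* The line of [v] in degree 0 and zero elsewhere. Overflowing powers respect this family because
   [c] vanishes on [Q]. *)
pose Y (k : nat) z := if k == 0%N then exists a, z = a *: v else z = 0.
have sY k : subspace (Y k).
  rewrite /Y; case: eqP => _; last first.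
    by split=> // a _ _ -> ->; rewrite scaler0 addr0.
  split=> [|a _ _ [b ->] [b' ->]]; first by exists 0; rewrite scale0r.
  by exists (a * b + b'); rewrite scalerDl scalerA.
have pY : power_stable Q ht Y.
  by move=> r k y Qr _; rewrite cQ // scale0r; case: (sY (k + unit_deg r * ht r)%N).
have Qadd2 r s Qr Qs e := (@Qadd r s Qr Qs e).2.
have st := @layers_enum_stable Q ht ht QD ht_gt0 Qadd Qadd2 _ p_gt1 pY.
have hk : weight ht ys (top_exponent par p ys) = weight ht qs (top_exponent par p qs).
  have wE us : weight ht us (top_exponent par p us) =
      (\sum_(r <- us) (unit_deg r).-1 * ht r)%N.
    by elim: us => [|r us IH] /=; rewrite ?big_nil // big_cons IH addnC.
  by rewrite !wE; apply: perm_big.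
have hL : layers ht qs Y (weight ht ys (top_exponent par p ys)) (top_op E ys v).
  have sub : {subset ys <= Q} by move=> r; rewrite (perm_mem hp) mem_ht_enum.
  have hi r a k z : Q r -> layers ht qs Y k z ->
      layers ht qs Y (k + a * ht r)%N (iter a (E r) z).
    move=> Qr hz; elim: a => [|a IH] /=; first by rewrite addn0.
    by rewrite mulSnr addnA; apply: st.
  rewrite -[weight _ _ _]add0n {hp hk}.
  have : layers ht qs Y 0 v by apply: sub_layers => //; exists 1; rewrite scale1r.
  move: {1 2}v => w; elim: ys 0%N w sub => [|x ys IH] k w sub hw; first by rewrite addn0.
  rewrite /= [(weight _ _ _ + _)%N]addnC addnA; apply: IH => //.
    by move=> r ry; apply: sub; rewrite inE ry orbT.
  by apply: hi => //; apply: sub; rewrite inE eqxx.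
pose P k z := k = weight ht qs (top_exponent par p qs) ->
  exists a, z = a *: top_op E qs v.
apply: (@layers_ind ht qs Y P _ _ _ _ hL hk) => [k|J k y hJ].
  split=> [_|a y z hy hz hk2]; first by exists 0; rewrite scale0r.
  have [[b ->] [b' ->]] := (hy hk2, hz hk2).
  by exists (a * b + b'); rewrite scalerDl scalerA.
rewrite /P /Y; case: eqP => [-> [a ->]|_ -> _]; last by exists 0; rewrite linear0 scale0r.
rewrite add0n => /weight_top -> //; first by exists a; rewrite linearZ.
by move=> r; rewrite mem_ht_enum.
Qed.

End Generation.
End Spanning.

(** * Weights *)

Section Eigenvector.
Variables (F : closedFieldType) (X : lmodType F) (f : {linear X -> X}).

Definition poly_act (q : {poly F}) (z : X) : X :=
  \sum_(i < size q) q`_i *: iter i f z.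

Lemma poly_act_widen n (q : {poly F}) z : (size q <= n)%N ->
  poly_act q z = \sum_(i < n) q`_i *: iter i f z.
Proof.
move=> le; rewrite /poly_act (big_ord_widen n (fun i => q`_i *: iter i f z)) //.
rewrite big_mkcond; apply: eq_bigr => i _; case: ltnP => // h.
by rewrite nth_default ?scale0r.
Qed.

Lemma poly_act_XsubC (q : {poly F}) r z :
  poly_act (('X - r%:P) * q)%R z = f (poly_act q z) - r *: poly_act q z.
Proof.
have le : (size (('X - r%:P) * q)%R <= (size q).+1)%N.
  by apply: leq_trans (size_polyMleq _ _) _; rewrite size_XsubC.
rewrite (poly_act_widen _ le) /poly_act linear_sum scaler_sumr /=.
under eq_bigr do rewrite mulrBl coefB coefXM coefCM scalerBl.
rewrite sumrB; congr (_ - _); last first.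
  by rewrite big_ord_recr /= nth_default // mulr0 scale0r addr0; apply: eq_bigr => i _;
    rewrite scalerA.
rewrite big_ord_recl /= scale0r add0r; apply: eq_bigr => i _.
by rewrite linearZ.
Qed.

(** The annihilating polynomial replaces a dimension count: it splits into linear factors, and the
    first factor to turn a nonzero vector into zero yields the eigenvector. *)
Lemma exists_eigenvector (K : X -> Prop) (q : {poly F}) :
  subspace K -> (forall z, K z -> K (f z)) -> q != 0 ->
  (forall z, K z -> poly_act q z = 0) -> (exists z, K z /\ z != 0) ->
  exists a z, [/\ K z, z != 0 & f z = a *: z].
Proof.
move=> sK Kf q0 Kq [z [Kz z0]].
have [rs def_q] := closed_field_poly_normal q.
have lq : lead_coef q != 0 by rewrite lead_coef_eq0.
have : poly_act (\prod_(r <- rs) ('X - r%:P)) z = 0.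
  have := Kq z Kz; rewrite [in poly_act _ _]def_q; move: (\prod_(r <- rs) _) => g.
  rewrite /poly_act size_scale //; under eq_bigr do rewrite coefZ -scalerA.
  by rewrite -scaler_sumr => /eqP; rewrite scaler_eq0 (negPf lq) => /eqP.
have Kact g : K (poly_act g z).
  rewrite /poly_act; elim/big_rec: _ => [|i y _ Ky]; first by case: sK.
  by case: sK => _; apply=> //; elim: (i : nat) => //= j; exact: Kf.
elim: rs {def_q} => [|r rs IH].
  rewrite big_nil /poly_act size_poly1 big_ord1 coef1 /= scale1r => e.
  by rewrite e eqxx in z0.
rewrite big_cons poly_act_XsubC => /eqP; rewrite subr_eq0 => /eqP e.
set w := poly_act _ z in e; have [/IH //|w0] := eqVneq w 0.
by exists r, w; split=> //; exact: Kact.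
Qed.
End Eigenvector.

Section HighestWeight.
Variables (F : closedFieldType) (N : nat) (par : 'I_N -> bool) (p : nat).
Hypotheses (p_char : p \in [pchar F]) (p_gt2 : (2 < p)%N).
Local Notation idx := ('I_N * 'I_N)%type.
Implicit Types (r s t x : idx) (ys : seq idx).
Variables (D : pred idx) (c : idx -> F) (X : lmodType F).
Variable E : unit_action par p D c X.
Implicit Types z w y v : X.
Local Notation dg := (unit_deg par p).
Local Notation od := (unit_odd par).
Local Notation sg := (unit_sgn F par).
Hypothesis D_diag : forall i, D (i, i).

Definition is_weight (l : 'I_N -> F) v : Prop :=
  forall i, E (i, i) v = l i *: v.

Lemma exists_weight (K : X -> Prop) :
  subspace K -> (forall i z, K z -> K (E (i, i) z)) -> (exists z, K z /\ z != 0) ->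
  exists l z, [/\ K z, z != 0 & is_weight l z].
Proof.
move=> sK KE nzK.
suff [l [z [Kz z0 lz]]] : exists l z, [/\ K z, z != 0 &
    forall i, i \in enum 'I_N -> E (i, i) z = l i *: z].
  by exists l, z; split=> // i; apply: lz; rewrite mem_enum.
elim: (enum 'I_N) => [|j us [l [z [Kz z0 lz]]]].
  by case: nzK => z [Kz z0]; exists (fun=> 0), z.
pose K' w := K w /\ forall i, i \in us -> E (i, i) w = l i *: w.
(* [unit_op_diag] says that [E (j, j)] is a root of this Artin-Schreier polynomial. *)
pose q : {poly F} := 'X^p - ('X + (c (j, j))%:P).
have q_size : size q = p.+1.
  rewrite /q size_polyDl ?size_polyXn // size_polyN size_XaddC.
  by rewrite ltnS ltnW.
have [|||||a [w [[Kw lw] w0 aw]]] := @exists_eigenvector _ _ (E (j, j)) K' q.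
- split=> [|b y w [Ky ly] [Kw lw]].
    by split=> [|i _]; [case: sK|rewrite linear0 scaler0].
  split=> [|i iu]; first by case: sK => _; apply.
  by rewrite linearP ly // lw // scalerDr !scalerA mulrC.
- move=> w [Kw lw]; split=> [|i iu]; first exact: KE.
  rewrite (unit_op_br E) //= /unit_sgn /unit_odd /= !addbb expr0 !scale1r lw // linearZ /=.
  by rewrite eq_sym; case: eqP => [->|_]; rewrite ?addrK ?subr0 ?addr0.
- by rewrite -size_poly_eq0 q_size.
- move=> w _; rewrite /poly_act q_size.
  under eq_bigr do rewrite coefB coefXn coefD coefX coefC scalerBl.
  rewrite sumrB (bigD1 ord_max) //= eqxx scale1r big1 ?addr0; last first.
    move=> i /negPf ni; rewrite (_ : (i == p :> nat) = false) ?scale0r //.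
  rewrite (unit_op_diag E) //.
  under eq_bigr do rewrite scalerDl.
  have p0 : (0 < p.+1)%N by []; have p1 : (1 < p.+1)%N by lia.
  rewrite big_split /= (bigD1 (Ordinal p1)) //= scale1r big1 ?addr0; last first.
    move=> i /negPf ni; rewrite (_ : (i == 1 :> nat) = false) ?scale0r //.
  rewrite (bigD1 (Ordinal p0)) //= big1 ?addr0 ?subrr // => i /negPf ni.
  by rewrite (_ : (i == 0 :> nat) = false) ?scale0r.
- by exists z.
exists (fun i => if i == j then a else l i), w; split=> // i.
by rewrite inE; case: eqP => [->|_] //= iu; apply: lw.
Qed.

Lemma weight_op l v r : is_weight l v -> D r ->
  is_weight (fun i => l i + (i == r.1)%:R - (i == r.2)%:R) (E r v).
Proof.
case: r => a b lv Dr i; rewrite (unit_op_br E) //= lv linearZ /=.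
rewrite /unit_sgn /unit_odd /= addbb expr0 !scale1r scalerBl scalerDl.
congr (_ + _ - _); first by case: eqP => [->|_]; rewrite ?scale1r ?scale0r.
by rewrite eq_sym; case: eqP => [->|_]; rewrite ?scale1r ?scale0r.
Qed.

Lemma weight_iter l v r k : is_weight l v -> D r ->
  is_weight (fun i => l i + ((i == r.1)%:R - (i == r.2)%:R) *+ k) (iter k (E r) v).
Proof.
move=> lv Dr; elim: k => [|k IH] i /=; first by rewrite mulr0n addr0.
by have := weight_op IH Dr i; rewrite mulrSr addrA addrA.
Qed.

Variable chi : 'I_N -> F.
Hypothesis c_diag : forall i, c (i, i) = chi i ^+ p.

Lemma weight_eq l v i : is_weight l v -> v != 0 -> l i ^+ p = l i + chi i ^+ p.
Proof.
move=> lv v0; have it k : iter k (E (i, i)) v = l i ^+ k *: v.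
  by elim: k => [|k IH]; rewrite ?expr0 ?scale1r //= IH linearZ lv /= scalerA -exprSr.
have : (l i ^+ p - (l i + chi i ^+ p)) *: v = 0.
  rewrite scalerBl; have := unit_op_diag E v (D_diag i); rewrite lv c_diag -scalerDl => <-.
  by rewrite it subrr.
by move/eqP; rewrite scaler_eq0 (negPf v0) orbF subr_eq0 => /eqP.
Qed.

(** Frobenius fixes the prime field element [k%:R] and the sign. Applied to a supposed equality, it
    leaves by [weight_eq] the p-th power of the value of [chi], which would have to be 0. *)
Lemma weight_sub_neq l v i j (b : bool) k : is_weight l v -> v != 0 ->
  chi i - (-1) ^+ b * chi j != 0 -> l i - (-1) ^+ b * l j - k%:R != 0.
Proof.
move=> lv v0; apply: contra; rewrite subr_eq0 => /eqP e.
have := congr1 (pFrobenius_aut p_char) e.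
rewrite rmorph_nat rmorphB rmorphM rmorph_sign /= !pFrobenius_autE.
rewrite !(weight_eq _ lv v0) -e mulrDr opprD addrACA.
rewrite -[RHS]addr0 => /addrI h.
apply/eqP/(@fmorph_inj _ _ (pFrobenius_aut p_char)).
by rewrite rmorph0 rmorphB rmorphM rmorph_sign /= !pFrobenius_autE.
Qed.

(* The lowering operator is injective on the highest weight string because no
   weight takes a value in the prime field on the coroot. *)
Lemma lower_top_neq0 l v i j : D (i, j) -> D (j, i) -> i != j ->
  is_weight l v -> v != 0 -> E (i, j) v = 0 ->
  chi i - (-1) ^+ od (i, j) * chi j != 0 ->
  iter (dg (j, i)).-1 (E (j, i)) v != 0.
Proof.
move=> Dij Dji ij lv v0 ev chi_ij.
have odd_ji : od (j, i) = od (i, j) by rewrite /unit_odd addbC.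
have br z : E (i, j) (E (j, i) z) = sg (i, j) (j, i) *: E (j, i) (E (i, j) z)
    + E (i, i) z - sg (i, j) (j, i) *: E (j, j) z.
  by rewrite (unit_op_br E) //= !eqxx.
rewrite /unit_deg odd_ji; case: ifP => [odd_ij|even_ij] /=.
  apply/eqP=> fv; have := br v; rewrite fv linear0 ev linear0 scaler0 add0r.
  rewrite !lv scalerA -scalerBl /unit_sgn odd_ji odd_ij expr1 => /esym/eqP.
  rewrite scaler_eq0 (negPf v0) orbF.
  have := weight_sub_neq 0 lv v0 chi_ij; rewrite odd_ij expr1 subr0.
  by move/negPf->.
have sg1 : sg (i, j) (j, i) = 1 by rewrite /unit_sgn even_ij.
pose mu := l i - l j.
(* The $sl_2$ formula $e f^{k+1}v=(k+1)(\mu-k)f^k v$; for $k+1<p$ neither factor vanishes. *)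
have ef k : E (i, j) (iter k.+1 (E (j, i)) v)
    = (k.+1%:R * (mu - k%:R)) *: iter k (E (j, i)) v.
  elim: k => [|k IH].
    by rewrite /= br sg1 !scale1r ev linear0 add0r !lv -scalerBl mul1r subr0.
  rewrite iterS br IH sg1 !scale1r linearZ /= -iterS.
  have lk := weight_iter k.+1 lv Dji; rewrite !lk /= !eqxx (negPf ij) eq_sym (negPf ij).
  rewrite -addrA -scalerBl -scalerDl; congr (_ *: _).
  by rewrite /= sub0r subr0 mulNrn -!natr1 /mu; ring.
have p_pr := pcharf_prime p_char.
suff: forall k, (k <= p.-1)%N -> iter k (E (j, i)) v != 0 by apply.
elim=> // k IH k_lt; apply/eqP=> h; have := ef k; rewrite h linear0 => /esym/eqP.
rewrite scaler_eq0 (negPf (IH (ltnW k_lt))) orbF mulf_eq0.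
have := weight_sub_neq k lv v0 chi_ij; rewrite even_ij expr0 mul1r -/mu => /negPf ->.
rewrite orbF -(dvdn_pcharf p_char) => /dvdn_leq.
by lia.
Qed.
End HighestWeight.

(** * Crossing walls *)

Section Gallery.
Variables (F : closedFieldType) (N : nat) (par : 'I_N -> bool) (p : nat).
Hypotheses (p_char : p \in [pchar F]) (p_gt2 : (2 < p)%N).
Local Notation idx := ('I_N * 'I_N)%type.
Implicit Types (r s t x : idx) (ys : seq idx).
Variables (c : idx -> F) (X : lmodType F).
Variable E : unit_action par p predT c X.
Implicit Types z w y v : X.
Variable beta : 'I_N -> nat.
Hypothesis beta_mono : forall i j : 'I_N, (i <= j)%N -> (beta i <= beta j)%N.

Definition lowering : pred idx := fun r => (beta r.2 < beta r.1)%N.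

(** An insertion sort that reverses the order of the blocks of [beta] and keeps the order inside
    each block. The indices [r.1] are moved to the left in increasing order. Each passes the smaller
    blocks one by one: these already stand reversed, so the lowest block comes first, and inside a
    block the largest index does. Every step exchanges two neighbours. *)
Definition gallery_le r s : bool :=
  (r.1 < s.1)%N || (r.1 == s.1 :> nat) && ((beta r.2 < beta s.2)%N ||
    (beta r.2 == beta s.2) && (s.2 <= r.2)%N).

Definition gallery_segment ys : Prop :=
  [/\ uniq ys, sorted gallery_le ys, {subset ys <= lowering} &
      forall r t, lowering r -> r \notin ys -> t \in ys -> gallery_le r t].

Fact gallery_le_total : total gallery_le.
Proof. by move=> [a b] [d e]; rewrite /gallery_le /=; lia. Qed.

Fact gallery_le_trans : transitive gallery_le.
Proof. by move=> [a b] [d e] [f g]; rewrite /gallery_le /=; lia. Qed.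

Fact gallery_le_anti r s : gallery_le r s -> gallery_le s r -> r = s.
Proof.
case: r s => [a b] [d e]; rewrite /gallery_le /= => h1 h2.
by congr (_, _); apply: val_inj => /=; lia.
Qed.

Definition gallery : seq idx := sort gallery_le (enum lowering).

Lemma gallery_segment_all : gallery_segment gallery.
Proof.
split.
- by rewrite sort_uniq enum_uniq.
- exact: (sort_sorted gallery_le_total).
- by move=> r; rewrite mem_sort mem_enum.
by move=> r t Qr; rewrite mem_sort mem_enum => /negP.
Qed.

Lemma gallery_segment_behead x ys : gallery_segment (x :: ys) -> gallery_segment ys.
Proof.
case=> /= /andP[_ uy] sx sub hi; split=> //.
- exact: path_sorted sx.
- by move=> r ry; apply: sub; rewrite inE ry orbT.
move=> r t Qr ry ty; have [->|rx] := eqVneq r x.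
  exact: (allP (order_path_min gallery_le_trans sx)).
by apply: hi; rewrite ?inE ?ty ?orbT // negb_or rx.
Qed.

(* The positive roots of the Borel subalgebra reached after crossing the walls
   outside ys. *)
Definition positive_at ys r : bool :=
  if (r.1 < r.2)%N then ~~ (lowering (r.2, r.1) && ((r.2, r.1) \notin ys))
  else lowering r && (r \notin ys).

Lemma gallery_crossed x ys r : gallery_segment (x :: ys) -> lowering r ->
  (r \notin x :: ys) = ~~ gallery_le x r.
Proof.
case=> _ sx _ hi Qr; apply/idP/idP => [rx|].
  apply/negP=> xr; have h : gallery_le r x by apply: hi; rewrite ?inE ?eqxx.
  by move: rx; rewrite (gallery_le_anti h xr) inE eqxx.
apply: contra; rewrite inE => /predU1P[->|ry].
  by have := gallery_le_total x x; rewrite orbb.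
exact: (allP (order_path_min gallery_le_trans sx)).
Qed.

Lemma positive_atE x ys r : gallery_segment (x :: ys) ->
  positive_at (x :: ys) r = if (r.1 < r.2)%N
    then ~~ (lowering (r.2, r.1) && ~~ gallery_le x (r.2, r.1))
    else lowering r && ~~ gallery_le x r.
Proof.
move=> h; rewrite /positive_at; case: ifP => _.
  by case: (boolP (lowering _)) => //= Q; rewrite (gallery_crossed h).
by case: (boolP (lowering _)) => //= Q; rewrite (gallery_crossed h).
Qed.

Lemma positive_at_behead x ys r : gallery_segment (x :: ys) ->
  positive_at ys r -> r != x -> positive_at (x :: ys) r.
Proof.
move=> h; rewrite /positive_at; case: r => a b /=.
case: ifP => _; rewrite inE negb_or.
  by move=> /nandP[] h' _; apply/nandP; [left|right; rewrite negb_and h' orbT].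
by move=> /andP[-> ->] ->.
Qed.

Lemma beta_lt i j : (beta i < beta j)%N -> (i < j)%N.
Proof. by apply: contraTT; rewrite -!leqNgt; apply: beta_mono. Qed.

(** The root [(i, j)] is simple at this stage: [i] and [j] are neighbours in the current order, so
    whatever precedes [j] and is not [i] precedes [i]. *)
Lemma positive_atDr i j ys (a : 'I_N) : gallery_segment ((j, i) :: ys) ->
  a != i -> positive_at ((j, i) :: ys) (a, j) -> positive_at ((j, i) :: ys) (a, i).
Proof.
move=> h ai; have Qji : (beta i < beta j)%N.
  by case: h => _ _ sub _; have := sub (j, i); rewrite inE eqxx; apply.
have ij := beta_lt Qji; move: ai; rewrite -val_eqE /=.
rewrite !positive_atE // /lowering /gallery_le /=.
have := @beta_mono a i; have := @beta_mono i a.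
have := @beta_mono a j; have := @beta_mono j a.
by case: ifP => ?; case: ifP => ?; lia.
Qed.

Lemma positive_atDl i j ys (b : 'I_N) : gallery_segment ((j, i) :: ys) ->
  b != j -> positive_at ((j, i) :: ys) (i, b) -> positive_at ((j, i) :: ys) (j, b).
Proof.
move=> h ai; have Qji : (beta i < beta j)%N.
  by case: h => _ _ sub _; have := sub (j, i); rewrite inE eqxx; apply.
have ij := beta_lt Qji; move: ai; rewrite -val_eqE /=.
rewrite !positive_atE // /lowering /gallery_le /=.
have := @beta_mono b i; have := @beta_mono i b.
have := @beta_mono b j; have := @beta_mono j b.
by case: ifP => ?; case: ifP => ?; lia.
Qed.

Variable chi : 'I_N -> F.
Hypothesis c_diag : forall i, c (i, i) = chi i ^+ p.
Hypothesis c_low : forall r, lowering r -> c r = 0.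
Hypothesis chi_lt : forall i j, (beta i < beta j)%N ->
  chi i - (-1) ^+ unit_odd par (i, j) * chi j != 0.

(* Each factor moves a highest weight vector across one wall, to a highest
   weight vector for the adjacent Borel subalgebra. *)
Lemma gallery_top_neq0 l v : is_weight E l v -> v != 0 ->
  (forall i j : 'I_N, (i < j)%N -> E (i, j) v = 0) ->
  top_op E gallery v != 0.
Proof.
move=> lv v0 hv.
have {hv} : forall r, positive_at gallery r -> E r v = 0.
  case=> i j; rewrite /positive_at /=; case: ifP => [ij _|_]; first exact: hv.
  by rewrite mem_sort mem_enum unfold_in andbN.
elim: gallery gallery_segment_all l v lv v0 => // -[j i] ys IH h l v lv v0 hv.
have Qji : (beta i < beta j)%N.
  by case: h => _ _ sub _; have := sub (j, i); rewrite inE eqxx; apply.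
have ij := beta_lt Qji; have ij' : i != j by rewrite -val_eqE neq_ltn ij.
have posij : positive_at ((j, i) :: ys) (i, j).
  by rewrite /positive_at /= ij inE eqxx /= andbF.
rewrite /top_op /= -/(top_op E ys); set k := (_.-1).
have neq : iter k (E (j, i)) v != 0.
  by apply: (lower_top_neq0 p_char p_gt2 _ c_diag _ _ _ lv) => //;
    [exact: hv|exact: chi_lt].
have wt := weight_iter (D := predT) (fun=> isT) k lv (isT : predT (j, i)).
apply: (IH (gallery_segment_behead h) _ _ wt neq) => r.
(* The newly positive root itself: one more factor completes its power, which is the scalar
   [c (j, i)], that is, 0. *)
have [-> _|rji pr] := eqVneq r (j, i).
  rewrite -iterS /k prednK; last by rewrite ltnW ?unit_deg_gt1 // ltnW.
  rewrite (unit_op_root E) //= 1?eq_sym // c_low ?scale0r //.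
have rij : r != (i, j).
  apply: contraTneq pr => ->; rewrite /positive_at /= ij /lowering /= Qji negbK /=.
  by case: h => /andP[].
have {pr} pr := positive_at_behead h pr rji.
(* Bracketing with [E (j, i)] leads again to positive roots other than [(i, j)], hence the induction
   over all [r]. *)
elim: k r pr rij {neq rji wt} => [|k IHk] r pr rij /=; first exact: hv.
rewrite (unit_op_br E) // IHk // linear0 scaler0 add0r.
case: r pr rij => a b /= pr rij.
have -> : (if b == j then E (a, i) (iter k (E (j, i)) v) else 0) = 0.
  case: eqP => // e; subst b; have ai : a != i by apply: contraNneq rij => ->.
  apply: IHk; first exact: positive_atDr pr.
  by apply/eqP=> -[_ e]; rewrite e eqxx in ij'.
case: eqP => [e|_]; last by rewrite subr0.
subst a; have bj : b != j by apply: contraNneq rij => ->.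
rewrite IHk ?scaler0 ?subr0 //; first exact: positive_atDl pr.
by apply/eqP=> -[e _]; rewrite e eqxx in ij'.
Qed.
End Gallery.

(** * Highest weight vectors *)

Section Highest.
Variables (F : closedFieldType) (N : nat) (par : 'I_N -> bool) (p : nat).
Hypotheses (p_char : p \in [pchar F]) (p_gt2 : (2 < p)%N).
Local Notation idx := ('I_N * 'I_N)%type.
Implicit Types (r s t x : idx).
Variables (D : pred idx) (c : idx -> F) (X : lmodType F).
Variable E : unit_action par p D c X.
Implicit Types z w y v : X.

Definition raising : pred idx := fun r => (r.1 < r.2)%N.
Definition raising_ht r : nat := (r.2 - r.1)%N.

Lemma raising_gt0 r : raising r -> (0 < raising_ht r)%N.
Proof. by rewrite /raising /raising_ht subn_gt0. Qed.

Lemma raising_add r s : raising r -> raising s -> r.2 = s.1 ->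
  raising (r.1, s.2) /\ raising_ht (r.1, s.2) = (raising_ht r + raising_ht s)%N.
Proof.
case: r s => [a b] [d e]; rewrite /raising /raising_ht /= => h1 h2 h3.
by move: h2; rewrite -h3; lia.
Qed.

Lemma exists_highest (K : X -> Prop) :
  (forall r, raising r -> D r) -> (forall i, D (i, i)) ->
  (forall r, raising r -> c r = 0) ->
  subspace K -> (forall r z, raising r -> K z -> K (E r z)) ->
  (forall i z, K z -> K (E (i, i) z)) -> (exists z, K z /\ z != 0) ->
  exists l v, [/\ K v, v != 0, is_weight E l v &
    forall r, raising r -> E r v = 0].
Proof.
move=> Dr Dd c0 sK KE Kd nzK.
have [z [Kz z0 kz]] := exists_killed Dr raising_gt0 raising_add c0 KE nzK.
pose K' v := K v /\ forall r, raising r -> E r v = 0.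
have [|||l [v [[Kv kv] v0 lv]]] := @exists_weight F N par p p_char p_gt2 D c X E Dd K'.
- split=> [|a y w [Ky ky] [Kw kw]].
    by split=> [|r Qr]; [case: sK|rewrite linear0].
  split=> [|r Qr]; first by case: sK => _; apply.
  by rewrite linearP ky // kw // scaler0 addr0.
- move=> i w [Kw kw]; split=> [|r Qr]; first exact: Kd.
  rewrite (unit_op_br E w (Dr _ Qr) (Dd i)) /= kw // linear0 scaler0 add0r.
  have [i1 i2] : (r.2 == i -> E (r.1, i) w = 0) /\ (i == r.1 -> E (i, r.2) w = 0).
    by case: r Qr => a b Qr /=; split=> /eqP e; subst i; exact: kw.
  by case: eqP => [/eqP/i1 ->|_]; case: eqP => [/eqP/i2 ->|_]; rewrite ?scaler0 subr0.
- by exists z.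
by exists l, v.
Qed.
End Highest.

(** * Injectivity of the product of all top powers *)

Section LoweringHeight.
Variables (N : nat) (beta : 'I_N -> nat).
Implicit Types r s : 'I_N * 'I_N.

Definition lowering_ht r : nat := (beta r.1 - beta r.2)%N.

Lemma lowering_gt0 r : lowering beta r -> (0 < lowering_ht r)%N.
Proof. by rewrite /lowering /lowering_ht subn_gt0. Qed.

Lemma lowering_add r s : lowering beta r -> lowering beta s -> r.2 = s.1 ->
  lowering beta (r.1, s.2) /\ lowering_ht (r.1, s.2) = (lowering_ht r + lowering_ht s)%N.
Proof.
case: r s => [a b] [d e]; rewrite /lowering /lowering_ht /= => h1 h2 h3.
by move: h2; rewrite -h3; lia.
Qed.

End LoweringHeight.

Section TopInjective.
Variables (F : closedFieldType) (N : nat) (par : 'I_N -> bool) (p : nat).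
Hypotheses (p_char : p \in [pchar F]) (p_gt2 : (2 < p)%N).
Local Notation idx := ('I_N * 'I_N)%type.
Implicit Types (r s t x : idx).
Variables (c : idx -> F) (X : lmodType F).
Variable E : unit_action par p predT c X.
Implicit Types z w y v : X.
Variable beta : 'I_N -> nat.
Hypothesis beta_mono : forall i j : 'I_N, (i <= j)%N -> (beta i <= beta j)%N.
Variable chi : 'I_N -> F.
Hypothesis c_diag : forall i, c (i, i) = chi i ^+ p.
Hypothesis c_low : forall r, lowering beta r -> c r = 0.
Hypothesis c_raise : forall r, raising r -> c r = 0.
Hypothesis chi_lt : forall i j, (beta i < beta j)%N ->
  chi i - (-1) ^+ unit_odd par (i, j) * chi j != 0.

Lemma top_op_inj (V : X -> Prop) : subspace V ->
  (forall r v, (beta r.1 <= beta r.2)%N -> V v -> V (E r v)) ->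
  (forall r v, (beta r.1 < beta r.2)%N -> V v -> E r v = 0) ->
  forall v, V v -> top_op E (ht_enum (lowering beta) (lowering_ht beta)) v = 0 -> v = 0.
Proof.
move=> sV VE Vkill v Vv Tv; apply/eqP; apply: contraT => v0.
have p_gt1 : (1 < p)%N by exact: ltnW.
set rs := ht_enum _ _ in Tv *; pose K z := V z /\ top_op E rs z = 0.
have KE q z : (beta q.1 <= beta q.2)%N -> K z -> K (E q z).
  rewrite leq_eqVlt => /orP[/eqP e|lt] [Vz Tz]; last first.
    by rewrite Vkill //; split; [case: sV|rewrite linear0].
  split; first by apply: VE => //; rewrite e.
  (* A Levi root moves an index inside its block, and the height of a lowering root depends on the
     blocks only. *)
  apply: (top_op_normalized (Q := lowering beta) (ht := lowering_ht beta)) => //.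
  - exact: lowering_gt0.
  - exact: lowering_add.
  - by move=> s; rewrite /lowering /lowering_ht /= => Qs h; rewrite e h.
  - by move=> s; rewrite /lowering /lowering_ht /= => Qs h; rewrite -e -h.
  - exact: ht_segment_enum.
  - by move=> r Qr; rewrite mem_ht_enum Qr.
have [||||||l [w [[Vw Tw] w0 lw hw]]] := @exists_highest F N par p p_char p_gt2 predT c X E K _ _ c_raise.
- by [].
- by [].
- split=> [|a y z [Vy Ty] [Vz Tz]]; first by split; [case: sV|rewrite linear0].
  split; first by case: sV => _; apply.
  have -> : top_op E rs (a *: y + z) = a *: top_op E rs y + top_op E rs z by exact: linearP.
  by rewrite Ty Tz scaler0 addr0.
- by move=> r z /ltnW/beta_mono; exact: KE.
- by move=> i z; apply: KE.
- by exists v.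
have := gallery_top_neq0 p_char p_gt2 beta_mono c_diag c_low chi_lt lw w0.
have [a ->] : exists a, top_op E (gallery beta) w = a *: top_op E rs w.
  have QD : forall r, lowering beta r -> predT r by [].
  apply: (top_op_perm E QD (@lowering_gt0 N beta) (@lowering_add N beta) p_gt1) => //.
  by rewrite /gallery /rs /ht_enum perm_sort perm_sym perm_sort.
by rewrite Tw scaler0 eqxx => h; apply: h => i j ij; apply: hw.
Qed.
End TopInjective.

(** * Reduced enveloping algebras *)

(** The envelopes are bare rings, so their modules carry no F-structure; this copy of [V] has the
    one coming from [eta]. *)
Definition restrict_scalars (F : fieldType) (A : pzRingType)
  (eta : {rmorphism F -> A}) (V : lmodType A) : Type := V.

Section RestrictScalars.
Variables (F : fieldType) (A : pzRingType) (eta : {rmorphism F -> A}).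
Variable V : lmodType A.
Local Notation W := (restrict_scalars eta V).

HB.instance Definition _ := GRing.Zmodule.on W.

Definition scalar_act (a : F) (v : W) : W := eta a *: (v : V).

Fact scalar_actA a b v : scalar_act a (scalar_act b v) = scalar_act (a * b) v.
Proof. by rewrite /scalar_act scalerA rmorphM. Qed.
Fact scalar_act1 : left_id 1 scalar_act.
Proof. by move=> v; rewrite /scalar_act rmorph1 scale1r. Qed.
Fact scalar_actDr : right_distributive scalar_act +%R.
Proof. by move=> a v w; rewrite /scalar_act -scalerDr. Qed.
Fact scalar_actDl v : {morph scalar_act^~ v : a b / a + b}.
Proof. by move=> a b; rewrite /scalar_act rmorphD -scalerDl. Qed.
HB.instance Definition _ := GRing.Zmodule_isLmodule.Build F W
  scalar_actA scalar_act1 scalar_actDr scalar_actDl.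

Lemma restrict_scaleE a (v : W) : a *: v = eta a *: (v : V) :> V.
Proof. by []. Qed.
End RestrictScalars.

Lemma rmorph_superbracket (A B : pzRingType) (f : {rmorphism A -> B}) (b : bool) x y z :
  f (x * y - (-1) ^+ b * (y * x) - z) = f x * f y - (-1) ^+ b * (f y * f x) - f z.
Proof. by rewrite !rmorphB !rmorphM rmorph_sign. Qed.

Section EnvelopeTheory.
Variables (F : fieldType) (m n p : nat).
Local Notation gl := 'M[F]_(m + n).
Variables (chi : {scalar gl}) (L : {vspace gl}).
Local Notation uL := (u p chi L).
Local Notation gen := (@ugen F m n p chi L).
Local Notation cst := (@ucst F m n p chi L).

Lemma rq_eq0 (A : pzRingType) (S : A -> Prop) s : S s -> rq S s = 0.
Proof.
move=> Ss; rewrite -(raddf0 (rq S)); apply/rq_eq; rewrite subr0.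
exact: ideal_genS.
Qed.

Definition of_free : freealg L -> uL := rq (@u_rel F m n p chi L) \o rq (@U_rel F m n L).
HB.instance Definition _ := GRing.RMorphism.on of_free.

Lemma of_free_surj q : exists g, q = of_free g.
Proof.
by exists (rq_repr (rq_repr q)); rewrite /of_free /= !rq_reprK.
Qed.

Fact ucst_zmod_morphism : zmod_morphism cst.
Proof. by move=> a b; rewrite -[LHS]/(of_free _) scalerBl (rmorphB of_free). Qed.
Fact ucst_monoid_morphism : monoid_morphism cst.
Proof.
split=> [|a b]; first by rewrite -[LHS]/(of_free _) scale1r (rmorph1 of_free).
rewrite -[LHS]/(of_free _) -[RHS]/(of_free _ * of_free _) -(rmorphM of_free).
by rewrite -scalerAl mul1r scalerA.
Qed.
HB.instance Definition _ := GRing.isZmodMorphism.Build F uL cst ucst_zmod_morphism.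
HB.instance Definition _ :=
  GRing.isMonoidMorphism.Build F uL cst ucst_monoid_morphism.

Lemma ucst_of_free a : cst a = of_free a%:A. Proof. by []. Qed.
Lemma ugen_of_free x : gen x = of_free (fgen x). Proof. by []. Qed.

Lemma freealg_word (w : {fmonom (subvs_of L)}) :
  << w >> = \prod_(x <- (w : seq _)) fgen x :> freealg L.
Proof.
case: w => s /=; elim: s => [|x s IH].
  by rewrite big_nil; congr << _ >>; apply: val_inj; rewrite /= fm1.
rewrite big_cons -IH /fgen malgM_def fgmulUU mulr1; congr << _ >>.
by apply: val_inj; rewrite /= fmM fmU.
Qed.

Lemma freealg_scaled (a : F) (w : {fmonom (subvs_of L)}) :
  << a *g w >> = a%:A * << w >> :> freealg L.
Proof.
rewrite mulr_algl; apply/malgP=> k.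
by rewrite (mcoeffU w a k) (mcoeffZ a << w >> k) (mcoeffU w 1 k) mulr_natr.
Qed.

Lemma u_generated (P : uL -> Prop) :
  (forall a, P (cst a)) -> (forall x, P (gen x)) ->
  (forall a b, P a -> P b -> P (a + b)) -> (forall a b, P a -> P b -> P (a * b)) ->
  forall q, P q.
Proof.
move=> Pc Pg PD PM q; have [g ->] := of_free_surj q.
have P0 : P 0 by have := Pc 0; rewrite (rmorph0 cst).
have P1 : P 1 by have := Pc 1; rewrite (rmorph1 cst).
rewrite [g]monalgE (rmorph_sum of_free).
elim/big_ind: _ => [|a b|w _]; [exact: P0|exact: PD|].
rewrite freealg_scaled (rmorphM of_free); apply: (PM); first exact: Pc.
rewrite freealg_word (rmorph_prod of_free).
elim: (w : seq _) => [|x s IH]; first by rewrite big_nil.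
rewrite big_cons; exact: (PM _ _ (Pg x) IH).
Qed.

Lemma ucst_central a (q : uL) : cst a * q = q * cst a.
Proof.
have [g ->] := of_free_surj q.
have e : a%:A * g = g * a%:A :> freealg L.
  by rewrite -mul_malgC mulr1; exact: malgC_central.
by rewrite ucst_of_free -(rmorphM of_free a%:A g) -(rmorphM of_free g a%:A) e.
Qed.

Lemma of_free_U_rel g : U_rel g -> of_free g = 0.
Proof. by move=> h; rewrite /of_free /= (rq_eq0 h) rmorph0. Qed.

Lemma ugenP a x y : gen (a *: x + y) = cst a * gen x + gen y.
Proof.
have /eqP := of_free_U_rel (U_rel_lin a x y).
rewrite (rmorphB of_free) subr_eq0 => /eqP e.
rewrite ugen_of_free e (rmorphD of_free) ucst_of_free -(rmorphM of_free).
by rewrite mulr_algl.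
Qed.

Lemma ugen0 : gen 0 = 0.
Proof.
have := ugenP 1 0 0; rewrite scaler0 addr0 (rmorph1 cst) mul1r => e.
by apply: (addrI (gen 0)); rewrite addr0 -e.
Qed.

Lemma ugenD x y : gen (x + y) = gen x + gen y.
Proof. by rewrite -[x in LHS]scale1r ugenP (rmorph1 cst) mul1r. Qed.

Lemma ugenZ a x : gen (a *: x) = cst a * gen x.
Proof. by rewrite -[_ *: _]addr0 ugenP ugen0 addr0. Qed.

Lemma ugen_br i j x y z :
  homog i (vsval x) -> homog j (vsval y) -> vsval z = sbr (vsval x) (vsval y) ->
  gen x * gen y = cst ((-1) ^+ (i && j)) * (gen y * gen x) + gen z.
Proof.
move=> hx hy hz; have /eqP := of_free_U_rel (U_rel_br hx hy hz).
rewrite (rmorph_superbracket of_free) (rmorph_sign cst (i && j)).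
by rewrite subr_eq0 subr_eq addrC => /eqP e; exact: e.
Qed.

Lemma ugen_p x y : homog false (vsval x) -> vsval y = vsval x ^+ p ->
  gen x ^+ p = gen y + cst (chi (vsval x) ^+ p).
Proof.
move=> hx hy; have /eqP := rq_eq0 (u_rel_p chi hx hy).
rewrite (rmorphB (rq (@u_rel F m n p chi L))) (rmorphB (rq (@u_rel F m n p chi L))).
rewrite (rmorphXn (rq (@u_rel F m n p chi L))) !subr_eq add0r => /eqP e.
by rewrite -[gen x ^+ p]/(rq _ (Ugen x) ^+ p) e addrC.
Qed.

End EnvelopeTheory.

(** * Matrix units *)

Section MatrixUnits.
Variables (F : fieldType) (m n : nat).
Local Notation gl := 'M[F]_(m + n).
Local Notation idx := ('I_(m + n) * 'I_(m + n))%type.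
Local Notation par := (@idx_odd m n).
Implicit Types r s : idx.

Definition unit_mx r : gl := delta_mx r.1 r.2.

Lemma part_unit k r : part k (unit_mx r) = if root_odd r == k then unit_mx r else 0.
Proof.
apply/matrixP=> i j; rewrite !mxE.
have [/andP[/eqP -> /eqP ->]|/negPf ne] := boolP ((i == r.1) && (j == r.2)).
  by rewrite -surjective_pairing; case: ifP; rewrite !mxE // !eqxx.
by rewrite !if_same; case: ifP; rewrite !mxE ?ne.
Qed.

Lemma homog_unit r : homog (root_odd r) (unit_mx r).
Proof. by rewrite /homog part_unit eqxx. Qed.

Lemma sbr_unit r s : sbr (unit_mx r) (unit_mx s) =
  (if r.2 == s.1 then unit_mx (r.1, s.2) else 0)
  - (if s.2 == r.1 then unit_sgn F par r s *: unit_mx (s.1, r.2) else 0).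
Proof.
rewrite /sbr (bigD1 (root_odd r)) //= [X in _ + X]big1 ?addr0; last first.
  move=> k /negPf kr; apply: big1 => l _.
  by rewrite !part_unit eq_sym kr mul0mx mulmx0 scaler0 subr0.
rewrite (bigD1 (root_odd s)) //= [X in _ + X]big1 ?addr0; last first.
  by move=> l /negPf ls; rewrite !part_unit [_ == l]eq_sym ls mul0mx mulmx0 scaler0 subr0.
rewrite !part_unit !eqxx /unit_mx !mul_delta_mx_cond /=.
congr (_ - _); first by case: eqP; rewrite ?mulr1n ?mulr0n.
by case: eqP => _; rewrite ?mulr1n // mulr0n scaler0.
Qed.

Lemma unit_mx_sum (x : gl) : x = \sum_i \sum_j x i j *: unit_mx (i, j).
Proof. exact: matrix_sum_delta. Qed.

Lemma unit_mx_expr p r : (1 < p)%N -> r.1 != r.2 -> unit_mx r ^+ p = 0.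
Proof.
case: p => [|[|p]] // _ ne; rewrite exprS exprS mulrA.
suff -> : unit_mx r * unit_mx r = 0 by rewrite mul0r.
by rewrite -mulmxE /unit_mx mul_delta_mx_cond eq_sym (negPf ne).
Qed.

Lemma unit_mx_diag_expr p i : (0 < p)%N -> unit_mx (i, i) ^+ p = unit_mx (i, i).
Proof.
case: p => // p _; elim: p => [|p IH]; first by rewrite expr1.
by rewrite exprS IH -mulmxE /unit_mx mul_delta_mx.
Qed.
End MatrixUnits.

(** * Algebras generated by matrix units *)

Section UnitAlgebra.
Variables (F : fieldType) (N : nat) (par : 'I_N -> bool) (p : nat).
Variables (D : pred ('I_N * 'I_N)) (c : 'I_N * 'I_N -> F).

(* An algebra with the presentation by matrix units of a reduced enveloping
   algebra, except that the relations are not required to be defining. *)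
Record unit_algebra (A : pzRingType) (hA : bool -> A -> Prop) := UnitAlgebra {
  alg_cst : {rmorphism F -> A};
  alg_gen : 'I_N * 'I_N -> A;
  alg_central : forall a x, alg_cst a * x = x * alg_cst a;
  alg_br : forall r s, D r -> D s ->
    alg_gen r * alg_gen s = alg_cst (unit_sgn F par r s) * (alg_gen s * alg_gen r)
      + (if r.2 == s.1 then alg_gen (r.1, s.2) else 0)
      - (if s.2 == r.1 then alg_cst (unit_sgn F par r s) * alg_gen (s.1, r.2) else 0);
  alg_root : forall r, D r -> r.1 != r.2 ->
    alg_gen r ^+ unit_deg par p r = alg_cst (c r);
  alg_diag : forall i, D (i, i) ->
    alg_gen (i, i) ^+ p = alg_gen (i, i) + alg_cst (c (i, i));
  alg_ind : forall P : A -> Prop, (forall a, P (alg_cst a)) ->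
    (forall r, D r -> P (alg_gen r)) -> (forall x y, P x -> P y -> P (x + y)) ->
    (forall x y, P x -> P y -> P (x * y)) -> forall x, P x;
  alg_hom0 : forall k, hA k 0;
  alg_hom_cst : forall a, hA false (alg_cst a);
  alg_hom_gen : forall r, D r -> hA (unit_odd par r) (alg_gen r);
  alg_homD : forall k x y, hA k x -> hA k y -> hA k (x + y);
  alg_homM : forall i j x y, hA i x -> hA j y -> hA (i (+) j) (x * y) }.

Variables (A : pzRingType) (hA : bool -> A -> Prop) (S : unit_algebra hA).

Definition homog_split (a : A) : Prop :=
  exists a0 a1, [/\ hA false a0, hA true a1 & a = a0 + a1].

(** Existence only: components are compared in modules, whose gradings are given. *)
Lemma alg_homog_split a : homog_split a.
Proof.
have hk k x : hA k x -> homog_split x.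
  by case: k => h; [exists 0, x|exists x, 0]; rewrite ?add0r ?addr0; split=> //;
    exact: (alg_hom0 S).
move: a; apply: (@alg_ind _ _ S) => [a|r Dr|_ _ [x0 [x1 [h1 h2 ->]]] [y0 [y1 [h3 h4 ->]]]
  |_ _ [x0 [x1 [h1 h2 ->]]] [y0 [y1 [h3 h4 ->]]]].
- exact: hk (alg_hom_cst S a).
- exact: hk (alg_hom_gen S Dr).
- by exists (x0 + y0), (x1 + y1); rewrite addrACA; split=> //; exact: (alg_homD S).
exists (x0 * y0 + x1 * y1), (x0 * y1 + x1 * y0); split.
- by apply: (alg_homD S); [exact: (alg_homM S h1 h3)|exact: (alg_homM S h2 h4)].
- by apply: (alg_homD S); [exact: (alg_homM S h1 h4)|exact: (alg_homM S h2 h3)].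
by rewrite mulrDl !mulrDr [x1 * y0 + _]addrC addrACA.
Qed.

Variable V : lmodType A.
Local Notation W := (restrict_scalars (alg_cst S) V).

Definition elt_act (a : A) (v : W) : W := a *: (v : V).

Fact elt_act_linear a : linear (elt_act a).
Proof.
move=> b v w; rewrite /elt_act scalerDr; congr (_ + _).
by rewrite !restrict_scaleE !scalerA alg_central.
Qed.
HB.instance Definition _ a :=
  GRing.isLinear.Build F W W _ (elt_act a) (elt_act_linear a).

Definition alg_ops r : {linear W -> W} := elt_act (alg_gen S r).

Lemma iter_elt_act k a (z : W) : iter k (elt_act a) z = elt_act (a ^+ k) z.
Proof.
elim: k => [|k IH] /=; first by rewrite /elt_act scale1r.
by rewrite IH /elt_act scalerA -exprS.
Qed.

Fact alg_ops_br r s (z : W) : D r -> D s ->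
  alg_ops r (alg_ops s z) = unit_sgn F par r s *: alg_ops s (alg_ops r z)
    + (if r.2 == s.1 then alg_ops (r.1, s.2) z else 0)
    - (if s.2 == r.1 then unit_sgn F par r s *: alg_ops (s.1, r.2) z else 0).
Proof.
move=> Dr Ds; have := congr1 (fun a : A => a *: (z : V)) (alg_br S Dr Ds).
rewrite scalerBl scalerDl -!scalerA => e.
rewrite [LHS]e; congr (_ + _ - _); case: ifP => _ //; by rewrite ?scale0r -?scalerA.
Qed.

Fact alg_ops_root r (z : W) : D r -> r.1 != r.2 ->
  iter (unit_deg par p r) (alg_ops r) z = c r *: z.
Proof. by move=> Dr ne; rewrite iter_elt_act alg_root. Qed.

Fact alg_ops_diag i (z : W) : D (i, i) ->
  iter p (alg_ops (i, i)) z = alg_ops (i, i) z + c (i, i) *: z.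
Proof. by move=> Di; rewrite iter_elt_act alg_diag // /elt_act scalerDl. Qed.

Definition alg_action : unit_action par p D c W :=
  UnitAction alg_ops_br alg_ops_root alg_ops_diag.

Lemma alg_stable (P : W -> Prop) : subspace P ->
  (forall r v, D r -> P v -> P (alg_action r v)) ->
  forall (a : A) (v : V), P v -> P (a *: v).
Proof.
move=> sP PD.
apply: (@alg_ind _ _ S) => [a v|r Dr v|a b Ta Tb v Pv|a b Ta Tb v Pv].
- exact: (@subspaceZ _ W P a v sP).
- exact: PD.
- rewrite scalerDl; apply: (@subspaceD _ W P _ _ sP); [exact: Ta|exact: Tb].
by rewrite -scalerA; apply: Ta; apply: Tb.
Qed.
End UnitAlgebra.

(** * Reduced enveloping algebras in terms of matrix units *)

Section EnvelopeModule.
Variables (F : fieldType) (m n p : nat).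
Hypotheses (p_char : p \in [pchar F]) (p_gt2 : (2 < p)%N).
Local Notation gl := 'M[F]_(m + n).
Local Notation idx := ('I_(m + n) * 'I_(m + n))%type.
Local Notation par := (@idx_odd m n).
Variables (chi : {scalar gl}) (L : {vspace gl}).
Hypothesis chi_odd : forall x, homog true x -> chi x = 0.
Local Notation uL := (u p chi L).
Local Notation gen := (@ugen F m n p chi L).
Local Notation cst := (@ucst F m n p chi L).
Variable (D : pred idx).
Hypothesis DL : forall r, D r -> unit_mx F r \in L.
Hypothesis Dtr : forall i j k, D (i, j) -> D (j, k) -> D (i, k).

Definition unit_gen r : uL := gen (vsproj L (unit_mx F r)).

Definition unit_char r : F := chi (unit_mx F r) ^+ p.

Lemma unit_gen_br r s : D r -> D s ->
  unit_gen r * unit_gen s = cst (unit_sgn F par r s) * (unit_gen s * unit_gen r)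
    + (if r.2 == s.1 then unit_gen (r.1, s.2) else 0)
    - (if s.2 == r.1 then cst (unit_sgn F par r s) * unit_gen (s.1, r.2) else 0).
Proof.
move=> Dr Ds.
have Drs : r.2 == s.1 -> unit_mx F (r.1, s.2) \in L.
  by case: r s Dr Ds => [a b] [d e] /= Dr Ds /eqP h; apply/DL/(Dtr Dr); rewrite h.
have Dsr : s.2 == r.1 -> unit_mx F (s.1, r.2) \in L.
  by case: r s Dr Ds {Drs} => [a b] [d e] /= Dr Ds /eqP h; apply/DL/(Dtr Ds); rewrite h.
pose y1 := if r.2 == s.1 then vsproj L (unit_mx F (r.1, s.2)) else 0.
pose y2 := if s.2 == r.1 then vsproj L (unit_mx F (s.1, r.2)) else 0.
have vr : vsval (vsproj L (unit_mx F r)) = unit_mx F r by rewrite vsprojK ?DL.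
have vs : vsval (vsproj L (unit_mx F s)) = unit_mx F s by rewrite vsprojK ?DL.
have hr : homog (root_odd r) (vsval (vsproj L (unit_mx F r))) by rewrite vr homog_unit.
have hs : homog (root_odd s) (vsval (vsproj L (unit_mx F s))) by rewrite vs homog_unit.
have g1 : (if r.2 == s.1 then unit_gen (r.1, s.2) else 0) = gen y1.
  by rewrite /y1; case: ifP => // _; rewrite ugen0.
have g2 : (if s.2 == r.1 then cst (unit_sgn F par r s) * unit_gen (s.1, r.2) else 0)
    = cst (unit_sgn F par r s) * gen y2.
  by rewrite /y2; case: ifP => // _; rewrite ugen0 mulr0.
rewrite g1 g2 (ugen_br p chi (z := (- unit_sgn F par r s) *: y2 + y1) hr hs).
  by rewrite ugenP (rmorphN cst) mulNr [- _ + _]addrC addrA.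
rewrite vr vs sbr_unit linearP /= addrC scaleNr /y1 /y2; congr (_ - _).
  by case: ifP => [/Drs h|_]; rewrite ?vsprojK ?linear0.
by case: ifP => [/Dsr h|_]; rewrite ?vsprojK ?linear0 ?scaler0.
Qed.

Lemma unit_gen_root r : D r -> r.1 != r.2 ->
  unit_gen r ^+ unit_deg par p r = cst (unit_char r).
Proof.
move=> Dr ne; rewrite /unit_deg /unit_char.
have vr : vsval (vsproj L (unit_mx F r)) = unit_mx F r by rewrite vsprojK ?DL.
case: ifP => [odd_r|even_r].
  have -> : chi (unit_mx F r) = 0.
    by apply: chi_odd; have := homog_unit F r; rewrite [root_odd r]odd_r.
  rewrite expr0n (_ : (p == 0)%N = false) ?(rmorph0 cst); last by lia.
  (* For an odd root the bracket with itself says that the square equals its own negative; 2 is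
     invertible. *)
  have := unit_gen_br Dr Dr; rewrite eq_sym (negPf ne) addr0 subr0 /unit_sgn odd_r.
  rewrite expr1 (rmorphN1 cst) mulN1r expr2 => /eqP; rewrite -addr_eq0.
  have two : 2%:R != 0 :> F.
    by rewrite -(dvdn_pcharf p_char); apply/negP => /dvdn_leq; lia.
  move: (_ * _) => w /eqP e.
  rewrite -[w]mul1r -(rmorph1 cst) -(mulVf two) (rmorphM cst) (rmorph_nat cst).
  by rewrite -mulrA mulr_natl (mulr2n w) e mulr0.
rewrite /unit_gen (ugen_p chi (y := 0)) ?vr ?ugen0 ?add0r //.
  by have := homog_unit F r; rewrite [root_odd r]even_r.
by rewrite linear0 unit_mx_expr // ltnW.
Qed.

Lemma unit_gen_diag i : D (i, i) ->
  unit_gen (i, i) ^+ p = unit_gen (i, i) + cst (unit_char (i, i)).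
Proof.
move=> Di; rewrite /unit_gen /unit_char.
have e : vsval (vsproj L (unit_mx F (i, i))) = unit_mx F (i, i) by rewrite vsprojK ?DL.
rewrite (ugen_p chi (y := vsproj L (unit_mx F (i, i)))) ?e //.
  by have := homog_unit F (i, i); rewrite /root_odd addbb.
by rewrite unit_mx_diag_expr // (ltn_trans _ p_gt2).
Qed.

Hypothesis L_span : forall x i j, x \in L -> x i j != 0 -> D (i, j).

Lemma ugen_unit_sum x :
  gen x = \sum_(r | D r) cst (vsval x r.1 r.2) * unit_gen r.
Proof.
have gen_sum I (s : seq I) (P : pred I) f :
    gen (\sum_(i <- s | P i) f i) = \sum_(i <- s | P i) gen (f i).
  by elim/big_rec2: _ => [|i a b _ <-]; rewrite ?ugen0 // ugenD.
have e : x = \sum_(r | D r) vsval x r.1 r.2 *: vsproj L (unit_mx F r).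
  rewrite -[x in LHS]vsvalK [vsval x in LHS]unit_mx_sum.
  rewrite pair_big /= linear_sum (bigID D) /= [X in _ + X]big1 ?addr0.
    by apply: eq_bigr => -[i j] _; rewrite linearZ.
  move=> [i j] /= nD; rewrite (_ : vsval x i j = 0) ?scale0r ?linear0 //.
  by apply/eqP; apply: contraNT nD; apply: L_span; exact: subvsP.
by apply: etrans (congr1 gen e) _; rewrite gen_sum; apply: eq_bigr => r Dr; rewrite ugenZ.
Qed.

(** Transparent, so that its scalars and generators compute to [ucst] and [unit_gen], in terms of
    which the inclusion and the dimensions are stated. *)
Definition envelope_algebra :
  unit_algebra par p D unit_char (@u_hom F m n p chi L).
Proof.
apply: (@UnitAlgebra _ _ _ _ _ _ _ _ cst unit_gen).
- exact: ucst_central.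
- exact: unit_gen_br.
- exact: unit_gen_root.
- exact: unit_gen_diag.
- move=> P Pc Pg PD PM; apply: u_generated => // x.
  rewrite ugen_unit_sum; elim/big_ind: _ => [|//|r Dr].
    by have := Pc 0; rewrite (rmorph0 cst).
  by apply: PM; [exact: Pc|exact: Pg].
- by move=> k; rewrite -(ugen0 p chi L); apply: u_hom_gen; rewrite linear0 /homog linear0.
- exact: u_hom_cst.
- by move=> r Dr; apply: u_hom_gen; rewrite vsprojK ?DL // homog_unit.
- exact: u_homD.
exact: u_homM.
Defined.

End EnvelopeModule.

(** * Bases *)

Section Bases.
Variables (F : fieldType) (X : lmodType F).

Definition is_basis (T : finType) (b : T -> X) : Prop :=
  forall x, exists! a : {ffun T -> F}, x = \sum_t a t *: b t.

Lemma is_basisP (T : finType) (b : T -> X) :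
  (forall x, exists a : T -> F, x = \sum_t a t *: b t) ->
  (forall a : T -> F, \sum_t a t *: b t = 0 -> forall t, a t = 0) -> is_basis b.
Proof.
move=> sp fr x; have [a ->] := sp x; exists (finfun a); split.
  by apply: eq_bigr => t _; rewrite ffunE.
move=> a' e; apply/ffunP=> t; rewrite ffunE.
apply/eqP; rewrite -subr_eq0; apply/eqP/(fr (fun t => a t - a' t)).
by under eq_bigr do rewrite scalerBl; rewrite sumrB e subrr.
Qed.

Lemma exists_basis k (b : 'I_k -> X) :
  (forall x, exists a : 'I_k -> F, x = \sum_t a t *: b t) ->
  exists d (b' : 'I_d -> X), is_basis b'.
Proof.
elim: k b => [|k IH] b sp; first by exists 0%N, b; apply: is_basisP => // a _ [].
have [fr|] := pselect (forall a, \sum_t a t *: b t = 0 -> forall t, a t = 0).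
  by exists k.+1, b; apply: is_basisP.
move/existsNP=> [a /not_implyP[a0 /existsNP[i /eqP ai]]].
apply: (IH (b \o lift i)) => x; have [e ->] := sp x.
have bi : b i = \sum_j (- (a i)^-1 * a (lift i j)) *: b (lift i j).
  under eq_bigr do rewrite -scalerA.
  rewrite -scaler_sumr; apply: (scalerI ai).
  rewrite scalerA mulrN mulfV // scaleN1r; apply/eqP.
  rewrite -addr_eq0 -[X in _ == X]a0 (bigD1_ord i) //.
exists (fun j => e (lift i j) - e i * ((a i)^-1 * a (lift i j))).
rewrite (bigD1_ord i) //= {1}bi scaler_sumr -big_split; apply: eq_bigr => j _ /=.
by rewrite scalerA -scalerDl mulNr mulrN addrC.
Qed.

Lemma is_basis_enum (T : finType) (b : T -> X) :
  is_basis b -> is_basis (b \o @enum_val T predT).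
Proof.
move=> hb; apply: is_basisP => [x|a sum0 t].
  have [a [-> _]] := hb x; exists (a \o enum_val).
  by rewrite (reindex (@enum_val T predT)) //; apply: onW_bij; exact: enum_val_bij.
have [a0 [_ uniq0]] := hb 0.
have e1 := uniq0 [ffun=> 0].
have e2 := uniq0 [ffun t => a (enum_rank t)].
have {e1} e1 : a0 = [ffun=> 0].
  by apply: e1; rewrite big1 // => s _; rewrite ffunE scale0r.
have {}e2 : a0 = [ffun t => a (enum_rank t)].
  apply: e2; rewrite -{1}sum0 (reindex (@enum_rank T)) /=; last first.
    by apply: onW_bij; exact: enum_rank_bij.
  by apply: eq_bigr => s _; rewrite ffunE enum_rankK.
by move/ffunP/(_ (enum_val t)): e2; rewrite e1 !ffunE enum_valK.
Qed.
End Bases.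

Lemma has_dim_basis (F : fieldType) (A : pzRingType) (eta : {rmorphism F -> A})
    (V : lmodType A) (T : finType) (b : T -> restrict_scalars eta V) :
  is_basis b -> has_dim eta V #|T|.
Proof. by move=> hb; exists (b \o enum_val); apply: (is_basis_enum hb). Qed.

Lemma monomial_morph (F : fieldType) N (par : 'I_N -> bool) p D c (X Y : lmodType F)
    (E : unit_action par p D c X) (E' : unit_action par p D c Y) (h : X -> Y) :
  (forall r z, h (E r z) = E' r (h z)) ->
  forall ys J z, h (monomial E ys J z) = monomial E' ys J (h z).
Proof.
move=> hE; elim=> [|r ys IH] [|a J] z //=; rewrite IH; congr (monomial _ _ _ _).
by elim: a => //= a IHa; rewrite hE IHa.
Qed.

Lemma grading_sum0 (A : pzRingType) (hA : bool -> A -> Prop) (V : lmodType A)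
    (gV : bool -> V -> Prop) k x y : is_grading hA gV ->
  gV k x -> gV (~~ k) y -> x + y = 0 -> x = 0 /\ y = 0.
Proof.
case=> hB _ _ hI; wlog: k x y / k = false => [h|-> gx gy e].
  case: k => gx gy e; last exact: (h false x y).
  by rewrite addrC in e; have [] := h false y x erefl gy gx e.
have ex : x = - y by apply/eqP; rewrite -addr_eq0 e.
have [g0 gB] := hB true; have y0 : x = 0.
  by apply: hI => //; rewrite ex -sub0r; apply: gB.
by split=> //; apply: oppr_inj; rewrite -ex y0 oppr0.
Qed.

(** * Tensor products *)

Section TensorTheory.
Variables (A B : pzRingType) (f : {rmorphism B -> A}) (V : lmodType B).
Local Notation tens := (@tens A B f V).

Lemma tensDr a v w : tens a (v + w) = tens a v + tens a w.
Proof.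
rewrite /Defs.tens -raddfD; apply/tens_pi_eq.
by rewrite opprD addrA; exact: tens_relD.
Qed.

Lemma tensDl a b v : tens (a + b) v = tens a v + tens b v.
Proof. by rewrite /Defs.tens monalgUD raddfD. Qed.

Lemma tens_balanced a b v : tens (a * f b) v = tens a (b *: v).
Proof. by apply/tens_pi_eq; exact: tens_relM. Qed.

Lemma tensZ a b v : a *: tens b v = tens (a * b) v.
Proof. by rewrite /Defs.tens -formal_scaleU; exact: tens_scaleE. Qed.

Lemma tens_ind (P : tensor f V -> Prop) :
  P 0 -> (forall s t, P s -> P t -> P (s + t)) -> (forall a v, P (tens a v)) ->
  forall t, P t.
Proof.
move=> P0 PD Pt t; rewrite -[t]tens_reprK; move: (tens_repr t) => x.
by rewrite [x]monalgE raddf_sum; elim/big_ind: _ => // v _; exact: Pt.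
Qed.

Section Lift.
Variables (M : lmodType A) (iota : {additive V -> M}).
Hypothesis iota_lin : forall b v, iota (b *: v) = f b *: iota v.

Definition malg_lift (x : {malg A[V]}) : M := \sum_(v <- msupp x) x@_v *: iota v.

Lemma malg_liftEw (d : {fset V}) x : (msupp x `<=` d)%fset ->
  malg_lift x = \sum_(v <- d) x@_v *: iota v.
Proof.
move=> le; rewrite /malg_lift (big_fset_incl _ le) //= => v _ nv.
by rewrite mcoeff_outdom ?scale0r.
Qed.

Fact malg_lift_zmod_morphism : zmod_morphism malg_lift.
Proof.
move=> x y; pose d := (msupp x `|` msupp y)%fset.
rewrite (@malg_liftEw d (x - y)) ?msuppB_le // (@malg_liftEw d x) ?fsubsetUl //.
rewrite (@malg_liftEw d y) ?fsubsetUr // -sumrB; apply: eq_bigr => v _.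
by rewrite mcoeffB scalerBl.
Qed.
HB.instance Definition _ :=
  GRing.isZmodMorphism.Build {malg A[V]} M malg_lift malg_lift_zmod_morphism.

Lemma malg_liftU a v : malg_lift << a *g v >> = a *: iota v.
Proof.
by rewrite (@malg_liftEw [fset v]%fset) ?msuppU_le // big_seq_fset1 mcoeffUU.
Qed.

Lemma malg_lift_rel x : tens_rel f x -> malg_lift x = 0.
Proof.
elim=> [|y z _ hy _ hz|a v w|a b v]; first exact: raddf0.
- by rewrite raddfB /= hy hz subr0.
- by rewrite !raddfB /= !malg_liftU raddfD scalerDr addrAC addrK subrr.
by rewrite raddfB /= !malg_liftU iota_lin scalerA subrr.
Qed.

Definition tens_lift of (forall b v, iota (b *: v) = f b *: iota v) :=
  fun t : tensor f V => malg_lift (tens_repr t).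

Lemma tens_lift_pi x : tens_lift iota_lin (tens_pi f x) = malg_lift x.
Proof.
apply/eqP; rewrite -subr_eq0 -raddfB; apply/eqP/malg_lift_rel/tens_pi_eq.
exact: tens_reprK.
Qed.

Fact tens_lift_linear : linear (tens_lift iota_lin).
Proof.
move=> a s t; rewrite -[s]tens_reprK -[t]tens_reprK.
rewrite -[a *: _]/(tens_scale a _) tens_scaleE -raddfD !tens_lift_pi raddfD /=.
congr (_ + _); move: (tens_repr s) => x.
rewrite {1}[x]monalgE 2!raddf_sum /malg_lift scaler_sumr; apply: eq_bigr => v _ /=.
by rewrite -[LHS]/(malg_lift _) formal_scaleU malg_liftU scalerA.
Qed.
HB.instance Definition _ := GRing.isLinear.Build A (tensor f V) M _
  (tens_lift iota_lin) tens_lift_linear.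

Lemma tens_liftE a v : tens_lift iota_lin (tens a v) = a *: iota v.
Proof. by rewrite tens_lift_pi malg_liftU. Qed.

Variables (hA : bool -> A -> Prop) (gV : bool -> V -> Prop) (gM : bool -> M -> Prop).
Hypothesis hA_split : forall a, exists a0 a1, [/\ hA false a0, hA true a1 & a = a0 + a1].
Hypothesis gV_split : forall v, exists v0 v1, [/\ gV false v0, gV true v1 & v = v0 + v1].
Hypothesis gV0 : forall k, gV k 0.
Hypothesis gM_simple : graded_simple hA gM.
Hypothesis iota_deg : forall k v, gV k v -> gM k (iota v).

Lemma grading_add k x y : gM k x -> gM k y -> gM k (x + y).
Proof.
have [[hB _ _ _] _ _] := gM_simple; move=> gx gy; have [g0 gB] := hB k.
by rewrite -[y]opprK -[- y]sub0r; apply: (gB) => //; apply: gB.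
Qed.

Lemma grading_uniq x0 x1 y0 y1 : gM false x0 -> gM true x1 -> gM false y0 -> gM true y1 ->
  x0 + x1 = y0 + y1 -> x0 = y0 /\ x1 = y1.
Proof.
have [[hB _ _ hI] _ _] := gM_simple; have [_ gB0] := hB false; have [_ gB1] := hB true.
move=> h1 h2 h3 h4 e.
have e2 : x0 - y0 = y1 - x1.
  by apply/eqP; rewrite subr_eq addrAC eq_sym subr_eq addrC -e addrC.
have z : x0 - y0 = 0 by apply: hI; [exact: gB0|rewrite e2; exact: gB1].
split; first by apply/eqP; rewrite -subr_eq0 z.
by apply/esym/eqP; rewrite -subr_eq0 -e2 z.
Qed.

Lemma tens_lift_hom k t : tens_hom hA (f := f) gV k t -> gM k (tens_lift iota_lin t).
Proof.
have [[_ hZ _ _] _ _] := gM_simple.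
elim=> [i j a v ha gv|k' s t' _ hs _ ht]; last by rewrite linearD; exact: grading_add.
by rewrite tens_liftE; apply: hZ => //; apply: iota_deg.
Qed.

Lemma tens_hom_split t : exists t0 t1,
  [/\ tens_hom hA (f := f) gV false t0, tens_hom hA (f := f) gV true t1 & t = t0 + t1].
Proof.
elim/tens_ind: t => [|s t [s0 [s1 [h1 h2 ->]]] [t0 [t1 [h3 h4 ->]]]|a v].
- have [a0 [_ [h0 _ _]]] := hA_split 0; have t0 : tens a0 0 = 0.
    by apply: (addrI (tens a0 0)); rewrite addr0 -tensDr addr0.
  exists (tens a0 0), (tens a0 0); split; last by rewrite t0 addr0.
    exact: (@tens_hom_pure _ _ _ _ _ _ false false).
  exact: (@tens_hom_pure _ _ _ _ _ _ false true).
- exists (s0 + t0), (s1 + t1); rewrite addrACA.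
  by split=> //; exact: tens_homD.
have [a0 [a1 [h1 h2 ->]]] := hA_split a; have [v0 [v1 [h3 h4 ->]]] := gV_split v.
exists (tens a0 v0 + tens a1 v1), (tens a0 v1 + tens a1 v0); split.
- apply: tens_homD; first exact: (@tens_hom_pure _ _ _ _ _ _ false false).
  exact: (@tens_hom_pure _ _ _ _ _ _ true true).
- apply: tens_homD; first exact: (@tens_hom_pure _ _ _ _ _ _ false true).
  exact: (@tens_hom_pure _ _ _ _ _ _ true false).
by rewrite tensDl !tensDr [tens a1 v0 + _]addrC addrACA.
Qed.

(** The image of the canonical map is a nonzero graded submodule of the simple module [M], so
    surjectivity is free and injectivity is the only issue. *)
Lemma induced_graded_iso :
  (exists v : V, v != 0) -> injective iota -> injective (tens_lift iota_lin) ->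
  graded_iso gM (tens_hom hA (f := f) gV) /\
  forall x, exists t, x = tens_lift iota_lin t.
Proof.
move=> [v v0] inj_iota inj.
have [[_ _ M_split _] _ simple] := gM_simple.
have surj x : exists t, x = tens_lift iota_lin t.
  move: x; apply: simple; last first.
    exists (iota v); split; first by exists (tens 1 v); rewrite tens_liftE scale1r.
    by apply: contra v0 => /eqP e; apply/eqP/inj_iota; rewrite raddf0.
  split.
  - by exists 0; rewrite linear0.
  - by move=> _ _ [s ->] [t ->]; exists (s - t); rewrite linearB.
  - by move=> a _ [t ->]; exists (a *: t); rewrite linearZ.
  move=> x0 x1 h0 h1 [t e]; have [t0 [t1 [g0 g1 et]]] := tens_hom_split t.
  move: e; rewrite et linearD => /grading_uniq[] //; try exact: tens_lift_hom.
  by move=> -> ->; split; [exists t0|exists t1].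
split=> //.
pose g x := sval (cid (surj x)).
have gK x : tens_lift iota_lin (g x) = x by rewrite /g; case: (cid _) => t /= ->.
have g_lin : linear g by move=> a x y; apply: inj; rewrite gK linearP /= !gK.
pose gl : {linear M -> tensor f V} := HB.pack g (GRing.isLinear.Build A M (tensor f V) _ g g_lin).
exists gl; split.
  by exists (tens_lift iota_lin) => x; [exact: gK|apply: inj; rewrite gK].
move=> k x; split=> [gx|/tens_lift_hom]; last by rewrite gK.
(* Homogeneous components in the tensor product are not known to be unique; they are compared
   through their images in [M]. *)
have [t0 [t1 [g0 g1 et]]] := tens_hom_split (g x).
have ex : x = tens_lift iota_lin t0 + tens_lift iota_lin t1.
  by rewrite -{1}(gK x) et linearD.
have gM0 j : gM j 0 by have [[hB _ _ _] _ _] := gM_simple; case: (hB j).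
have := tens_lift_hom g0; have := tens_lift_hom g1 => G1 G0.
rewrite /= et; case: k gx => gx.
  have [|z _] := @grading_uniq 0 x _ _ (gM0 false) gx G0 G1; first by rewrite add0r.
  have -> : t0 = 0 by apply: inj; rewrite -z linear0.
  by rewrite add0r.
have [|_ z] := @grading_uniq x 0 _ _ gx (gM0 true) G0 G1; first by rewrite addr0.
have -> : t1 = 0 by apply: inj; rewrite -z linear0.
by rewrite addr0.
Qed.
End Lift.
End TensorTheory.

(** * The parabolic subalgebra *)

Section ParabolicRoots.
Variables (F : fieldType) (m n : nat).
Local Notation gl := 'M[F]_(m + n).
Local Notation idx := ('I_(m + n) * 'I_(m + n))%type.
Local Notation par := (@idx_odd m n).
Local Notation unit_mx := (@unit_mx F m n).
Variable chi : {scalar gl}.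
Implicit Types (r : idx) (i j k : 'I_(m + n)).

Definition diag_char (i : 'I_(m + n)) : F := chi (unit_mx (i, i)).

(* Up to sign, chi (h_alpha) is theta i - theta j for the root alpha of e_(i, j). *)
Definition theta (i : 'I_(m + n)) : F := (-1) ^+ par i * diag_char i.

Lemma chi_hroot r :
  chi (hroot F r) = diag_char r.1 - (-1) ^+ unit_odd par r * diag_char r.2.
Proof.
case: r => i j; rewrite /hroot -[delta_mx i j]/(unit_mx (i, j)).
rewrite -[delta_mx j i]/(unit_mx (j, i)) sbr_unit /= !eqxx raddfB /=.
rewrite linearZ /= /unit_sgn; congr (_ - _ ^+ _ * _).
by rewrite /unit_odd /= addbC andbb.
Qed.

Lemma chi_hroot_eq0 r : (chi (hroot F r) == 0) = (theta r.1 == theta r.2).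
Proof.
rewrite chi_hroot /theta subr_eq0 /unit_odd signr_addb -mulrA.
rewrite -(inj_eq (can_inj (signrMK (par r.1)))).
by rewrite signrMK.
Qed.

Lemma Phi'E r : Phi' chi r = (r.1 < r.2)%N && (theta r.1 != theta r.2).
Proof. by rewrite /Phi' /pos_root chi_hroot_eq0. Qed.

Lemma chis_unit i j : chis chi (unit_mx (i, j)) = if i == j then diag_char i else 0.
Proof.
rewrite /chis; case: eqP => [<-|ij].
  congr (chi _); apply/matrixP=> k l; rewrite !mxE /=.
  case: (k =P l) => // kl; case: (k =P i) => // ki; case: (l =P i) => // li.
  by case: kl; rewrite ki li.
rewrite (_ : (\matrix_(k, l) _) = 0) ?raddf0 //.
apply/matrixP=> k l; rewrite !mxE /=; case: (k =P l) => // <-.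
by case: (k =P i) => // ki; case: (k =P j) => // kj; case: ij; rewrite -ki -kj.
Qed.

(** [chis] sees only the diagonal, and $[e_{ab},e_{ji}]$ has a diagonal part only for
    $(a,b)=(i,j)$. *)
Lemma chis_sbr_unit (x : gl) i j :
  chis chi (sbr x (unit_mx (j, i))) = x i j * chi (hroot F (i, j)).
Proof.
pose f y : gl := sbr y (unit_mx (j, i)).
have f_lin : linear f by exact: sbr_linearl.
pose gl' : {linear gl -> gl} := HB.pack f (GRing.isLinear.Build F gl gl _ f f_lin).
have e : sbr x (unit_mx (j, i)) =
    \sum_r x r.1 r.2 *: sbr (unit_mx (r.1, r.2)) (unit_mx (j, i)).
  transitivity (gl' x) => //.
  rewrite {1}[x]unit_mx_sum pair_big (linear_sum gl'); apply: eq_bigr => r _.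
  by rewrite (linearZ_LR gl').
rewrite e (linear_sum (chis chi)).
under eq_bigr => r _ do rewrite (linearZ_LR (chis chi)) /=.
rewrite (bigD1 (i, j)) //= big1 ?addr0; last first.
  move=> [a b] ne; rewrite sbr_unit /= raddfB /=.
  have h : (a == i) && (b == j) = false by apply/negbTE; move: ne; rewrite xpair_eqE.
  have -> : chis chi (if b == j then unit_mx (a, i) else 0) = 0.
    case: (b =P j) h => [_|_ _]; last by rewrite /= (linear0 (chis chi)).
    by rewrite andbT chis_unit => ->.
  have -> : chis chi (if i == a then unit_sgn F par (a, b) (j, i) *: unit_mx (j, b) else 0) = 0.
    rewrite [i == a]eq_sym; case: (a =P i) h => [_|_ _];
      last by rewrite /= (linear0 (chis chi)).
    by rewrite /= (linearZ_LR (chis chi)) /= chis_unit eq_sym => ->; rewrite mulr0.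
  by rewrite subrr mulr0.
rewrite chi_hroot sbr_unit /= !eqxx raddfB /= linearZ /= !chis_unit !eqxx.
by rewrite /unit_sgn /unit_odd /= [par j (+) _]addbC andbb.
Qed.

Lemma mem_levi'_entries (x : gl) :
  x \in levi' chi <-> forall i j, x i j * chi (hroot F (i, j)) = 0.
Proof.
split=> [/mem_levi' h i j|h]; first by rewrite -chis_sbr_unit.
rewrite memv_ker lfunE /=; apply/eqP/matrixP=> j i; rewrite !mxE.
by rewrite -[delta_mx j i]/(unit_mx (j, i)) chis_sbr_unit.
Qed.

Lemma mem_nilrad_entries (x : gl) i j : x \in nilrad chi -> x i j != 0 -> Phi' chi (i, j).
Proof.
case/memv_sumP=> v hv ->; apply: contraR => nP.
rewrite summxE big1 // => r Pr; have /vlineP[a ->] := hv r Pr.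
rewrite !mxE; case: eqP => [ei|]; rewrite ?mulr0 //.
case: eqP => [ej|]; rewrite ?mulr0 //.
by case: r Pr ei ej => /= k l Pr ki lj; subst; rewrite Pr in nP.
Qed.

Lemma mem_borel_unit r : (r.1 <= r.2)%N -> unit_mx r \in borel F m n.
Proof.
move=> le; apply: (subvP (sumv_sup r le (subvv _))).
exact: memv_line.
Qed.

Hypothesis chi_npos : forall r, pos_root r -> chi (delta_mx r.1 r.2) = 0.
Hypothesis chin_Phi' : forall r, Phi' chi r -> chin chi (delta_mx r.2 r.1) = 0.
Hypothesis parab_subalg : subalg (parab chi).
Hypothesis parab_nil : is_nilradical (parab chi) (levi' chi) (nilrad chi).

Lemma levi'_sub_parab x : x \in levi' chi -> x \in parab chi.
Proof. by case: parab_nil => _ _ <- _; apply: (subvP (addvSl _ _)). Qed.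

Lemma borel_sub_parab x : x \in borel F m n -> x \in parab chi.
Proof. exact: (subvP (addvSl _ _)). Qed.

Lemma parab_entries x i j : x \in parab chi -> x i j != 0 ->
  (theta i == theta j) || (i < j)%N.
Proof.
case: parab_nil => _ _ <- _ /memv_addP[l hl [v hv ->]].
rewrite mxE; have [->|li] := eqVneq (l i j) 0.
  by rewrite add0r => /(mem_nilrad_entries hv); rewrite Phi'E /= => /andP[-> _];
    rewrite orbT.
move/mem_levi'_entries: hl => /(_ i j)/eqP; rewrite mulf_eq0 (negPf li) /=.
by rewrite chi_hroot_eq0 => ->.
Qed.

Lemma unit_mx_levi' i j : theta i = theta j -> unit_mx (i, j) \in levi' chi.
Proof.
move=> e; apply/mem_levi'_entries=> k l; rewrite mxE /=.
case: (k =P i) => [->|_]; rewrite ?mul0r //; case: (l =P j) => [->|_]; rewrite ?mul0r //.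
by apply/eqP; rewrite mul1r chi_hroot_eq0 /= e.
Qed.

(** The bracket of $e_{ij}$ in the Borel subalgebra with $e_{jk}$ in the Levi part has a nonzero
    entry at $(i,k)$. It lies in [parab], whose elements have entries below the diagonal only inside
    the classes of [theta]. *)
Lemma theta_interval i j k : (i < j)%N -> theta j = theta k -> theta i != theta k ->
  (i < k)%N.
Proof.
move=> ij jk ik.
have h1 : unit_mx (i, j) \in parab chi by apply/borel_sub_parab/mem_borel_unit/ltnW.
have h2 : unit_mx (j, k) \in parab chi by apply/levi'_sub_parab/unit_mx_levi'.
have := parab_subalg h1 h2; rewrite sbr_unit /= eqxx.
have -> : (k == i) = false by apply: contraNF ik => /eqP ->.
rewrite subr0 => h; have := @parab_entries _ i k h; rewrite (negPf ik) /=; apply.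
by rewrite mxE !eqxx oner_neq0.
Qed.

(* The classes of theta are intervals; they are numbered by their minima. *)
Definition block (i : 'I_(m + n)) : nat := [arg min_(k < i | theta k == theta i) (k : nat)].

Lemma blockP i : exists2 k : 'I_(m + n), block i = k & theta k = theta i /\
  forall l : 'I_(m + n), theta l = theta i -> (block i <= l)%N.
Proof.
rewrite /block; case: arg_minnP => // k /eqP tk hk; exists k => //.
by split=> // l /eqP; apply: hk.
Qed.

Lemma eq_block i j : (block i == block j) = (theta i == theta j).
Proof.
have [k bi [ti hi]] := blockP i; have [l bj [tj hj]] := blockP j.
apply/eqP/eqP => [|e].
  by rewrite bi bj => /val_inj e; rewrite -ti e.
by apply/eqP; rewrite eqn_leq {1}bj hi ?tj //= bi hj ?ti.
Qed.

Lemma block_mono i j : (i <= j)%N -> (block i <= block j)%N.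
Proof.
rewrite leq_eqVlt => /predU1P[/val_inj -> //|ij].
have [k bi [ti hi]] := blockP i; have [l bj [tj hj]] := blockP j.
have [e|ne] := eqVneq (theta i) (theta j).
  by have /eqP -> : block i == block j by rewrite eq_block e eqxx.
(* [block i] is at most [i], and [i] lies below the whole class of [j], in particular below its
   minimum [l]. *)
rewrite bj; apply: leq_trans (hi i erefl) (ltnW _).
by apply: (@theta_interval i j l) => //; rewrite tj.
Qed.

Lemma block_lt i j : (block i < block j)%N = (i < j)%N && (theta i != theta j).
Proof.
rewrite -eq_block; apply/idP/andP => [lt|[ij ne]].
  split; last by rewrite neq_ltn lt.
  by apply: contraTT lt; rewrite -!leqNgt; exact: block_mono.
by rewrite ltn_neqAle ne block_mono // ltnW.
Qed.

Lemma Phi'_block r : Phi' chi r = (block r.1 < block r.2)%N.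
Proof. by rewrite Phi'E block_lt. Qed.

Definition parab_root : pred idx := fun r => (block r.1 <= block r.2)%N.

Lemma parab_unit r : parab_root r -> unit_mx r \in parab chi.
Proof.
case: r => i j; rewrite /parab_root /= leq_eqVlt => /orP[|].
  by rewrite eq_block => /eqP e; apply/levi'_sub_parab/unit_mx_levi'.
rewrite block_lt => /andP[ij _].
by apply/borel_sub_parab/mem_borel_unit/ltnW.
Qed.

Lemma parab_span x i j : x \in parab chi -> x i j != 0 -> parab_root (i, j).
Proof.
move=> hx xij; have := parab_entries hx xij; rewrite -eq_block /parab_root /=.
by case/orP=> [/eqP ->|/ltnW/block_mono].
Qed.

Lemma diag_char_neq i j : (block i < block j)%N ->
  diag_char i - (-1) ^+ unit_odd par (i, j) * diag_char j != 0.
Proof.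
by move=> lt; have := chi_hroot (i, j) => /= <-; rewrite chi_hroot_eq0 -eq_block neq_ltn lt.
Qed.

Lemma unit_char_lowering p r : (0 < p)%N -> lowering block r -> unit_char p chi r = 0.
Proof.
case: r => j i p0 lt; rewrite /unit_char.
have Pr : Phi' chi (i, j) by rewrite Phi'_block.
have := chin_Phi' Pr; rewrite /chin /= -[delta_mx j i]/(unit_mx (j, i)) chis_unit.
rewrite ifN ?subr0 => [->|]; first by rewrite expr0n eqn0Ngt p0.
by rewrite -val_eqE /= neq_ltn; move: lt; rewrite /lowering block_lt => /andP[-> _];
  rewrite orbT.
Qed.

Lemma unit_char_raising p r : (0 < p)%N -> raising r -> unit_char p chi r = 0.
Proof.
move=> p0 Pr; rewrite /unit_char [chi _](chi_npos Pr).
by rewrite expr0n eqn0Ngt p0.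
Qed.

Lemma dim_unit_sum (P : pred idx) : \dim (\sum_(r | P r) <[unit_mx r]>)%VS = #|P|.
Proof.
have /directvP /= -> : directv (\sum_(r | P r) <[unit_mx r]>).
  apply/directv_sum_independent=> us hus sum0 r Pr.
  have /fin_all_exists[a ea] : forall r, exists b, P r -> us r = b *: unit_mx r.
    move=> s; case: (boolP (P s)) => [/hus/vlineP[b ->]|_]; first by exists b.
    by exists 0.
  rewrite ea // (_ : a r = 0) ?scale0r //.
  have := congr1 (fun x : gl => x r.1 r.2) sum0.
  rewrite summxE mxE (bigD1 r) //= ea // !mxE !eqxx mulr1 big1 ?addr0 //.
  move=> s /andP[Ps sr]; rewrite ea // !mxE.
  case: eqP => [e1|]; rewrite ?mulr0 //; case: eqP => [e2|]; rewrite ?mulr0 //.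
  by case/eqP: sr; rewrite [s]surjective_pairing -e1 -e2 -surjective_pairing.
rewrite -sum1_card; apply: eq_bigr => r _; rewrite dim_vline.
suff -> : unit_mx r != 0 by [].
apply/eqP=> /matrixP/(_ r.1 r.2)/eqP; by rewrite !mxE !eqxx oner_eq0.
Qed.

Lemma size_exponents p (ys : seq idx) :
  size (exponents par p ys) = (\prod_(r <- ys) unit_deg par p r)%N.
Proof.
elim: ys => [|r ys IH]; first by rewrite big_nil.
by rewrite big_cons /= size_allpairs size_iota IH.
Qed.

(** Transposition matches the lowering roots with [Phi']; each contributes [p] or 2 reduced
    exponents according to its parity. *)
Lemma size_exponents_lowering p ht :
  size (exponents par p (ht_enum (lowering block) ht)) =
  (p ^ \dim (nil_part chi false) * 2 ^ \dim (nil_part chi true))%N.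
Proof.
rewrite size_exponents /nil_part !dim_unit_sum.
have -> : (\prod_(r <- ht_enum (lowering block) ht) unit_deg par p r =
    \prod_(r | lowering block r) unit_deg par p r)%N.
  by rewrite -big_enum /=; apply: perm_big; rewrite perm_sort.
pose sw (r : idx) := (r.2, r.1).
have swK : involutive sw by case.
rewrite (reindex_inj (inv_inj swK)) /=.
under eq_bigl => r do rewrite /lowering /= -Phi'_block.
rewrite (bigID (fun r => root_odd r == false)) /=; congr (_ * _)%N.
  rewrite -prod_nat_const; apply: eq_bigr => r /andP[_ /eqP e].
  by rewrite /unit_deg /unit_odd /= addbC -/(root_odd r) e.
rewrite -prod_nat_const; apply: eq_big => [r|r /andP[_ e]].
  by rewrite unfold_in; case: (root_odd r).
by rewrite /unit_deg /unit_odd /= addbC -/(root_odd r); case: (root_odd r) e.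
Qed.
End ParabolicRoots.

(** * Induced modules *)

Section ParabolicModule.
Variables (F : closedFieldType) (N : nat) (par : 'I_N -> bool) (p : nat).
Hypotheses (p_char : p \in [pchar F]) (p_gt2 : (2 < p)%N).
Local Notation idx := ('I_N * 'I_N)%type.
Variables (c : idx -> F) (beta : 'I_N -> nat).
Hypothesis beta_mono : forall i j : 'I_N, (i <= j)%N -> (beta i <= beta j)%N.
Hypothesis c_raise : forall r, raising r -> c r = 0.
Local Notation DP := (fun r : idx => (beta r.1 <= beta r.2)%N).
Variables (B : pzRingType) (hB : bool -> B -> Prop).
Variable SB : unit_algebra par p DP c hB.
Variables (V : lmodType B) (gV : bool -> V -> Prop).
Hypothesis V_simple : graded_simple hB gV.
Local Notation W := (restrict_scalars (alg_cst SB) V).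
Let E : unit_action par p DP c W := alg_action SB V.

Lemma parabolic_highest : exists l (v : W),
  [/\ v != 0, is_weight E l v & forall r, raising r -> E r v = 0].
Proof.
have [_ [v v0] _] := V_simple.
have [||||||l [w [_ w0 lw hw]]] := @exists_highest F N par p p_char p_gt2 DP c W E
    (fun=> True) _ _ c_raise; first last.
- by exists l, w.
- by exists v.
all: by [] || move=> r; exact: (fun h => beta_mono (ltnW h)).
Qed.

Lemma nilradical_trivial r (v : V) :
  (beta r.1 < beta r.2)%N -> alg_gen SB r *: v = 0.
Proof.
move=> r_lt; have [hgr nz simple] := V_simple; have [hB0 hZ _ _] := hgr.
pose K (v : W) := forall r, (beta r.1 < beta r.2)%N -> E r v = 0.
have sK : subspace K.
  split=> [s _|a y z hy hz s hs]; first by rewrite linear0.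
  by rewrite linearP hy // hz // scaler0 addr0.
have gK : graded_submodule gV (K : V -> Prop).
  split.
  - by case: sK.
  - by move=> y z; exact: (@subspaceB F W K y z sK).
  (* Composing a strict increase of [beta] with a weak one gives a strict one, so both bracket terms
     again kill [x]. *)
  - move=> a x; apply: (@alg_stable _ _ _ _ _ _ _ _ SB V K sK) => {x} q x Dq hx s hs.
    rewrite [LHS](unit_op_br E) ?(ltnW hs) // hx // linear0 scaler0 add0r.
    case: eqP => [e|_]; last first.
      case: eqP => [e|_]; last by rewrite subr0.
      by rewrite hx ?scaler0 ?subr0 //=; apply: leq_ltn_trans Dq _; rewrite e.
    rewrite hx ?add0r /=; last by apply: leq_trans hs _; rewrite e.
    case: eqP => [e'|_]; last by rewrite oppr0.
    by rewrite hx ?scaler0 ?oppr0 //=; apply: leq_ltn_trans Dq _; rewrite e'.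
  move=> x0 x1 g0 g1 hx.
  have h s : (beta s.1 < beta s.2)%N -> E s x0 = 0 /\ E s x1 = 0.
    move=> hs; have hgen := alg_hom_gen SB (ltnW hs).
    apply: (grading_sum0 (k := unit_odd par s) hgr).
    - by rewrite -[unit_odd par s]addbF; exact: hZ hgen g0.
    - by rewrite -addbT; exact: hZ hgen g1.
    by have := hx s hs; rewrite linearD.
  by split=> s /h[].
apply: (simple _ gK) => //.
have [l [w [w0 _ hw]]] := parabolic_highest.
exists w; split=> // s hs; apply: hw; rewrite /raising.
by apply: contraTT hs; rewrite -!leqNgt; exact: beta_mono.
Qed.

(** Simplicity is graded, and a homogeneous vector is sure to generate a graded submodule. Root
    vectors are homogeneous, so a nonzero component of a highest weight vector is one too. *)
Lemma parabolic_homog_highest : exists k l (v : W),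
  [/\ v != 0, gV k v, is_weight E l v & forall r, raising r -> E r v = 0].
Proof.
have [hgr _ _] := V_simple; have [hB0 hZ hsplit _] := hgr.
have [l [v [v0 lv hv]]] := parabolic_highest.
have [x0 [x1 [g0 g1 ev]]] := hsplit v.
have Zk k a x : gV k x -> gV k ((a : F) *: (x : W)).
  by move=> gx; exact: hZ (alg_hom_cst SB a) gx.
have hx r : raising r -> E r x0 = 0 /\ E r x1 = 0.
  move=> Qr; have Dr : DP r by apply/beta_mono/ltnW.
  have hgen := alg_hom_gen SB Dr.
  apply: (grading_sum0 (k := unit_odd par r) hgr).
  - by rewrite -[unit_odd par r]addbF; exact: hZ hgen g0.
  - by rewrite -addbT; exact: hZ hgen g1.
  by have := hv r Qr; rewrite ev linearD.
have lx i : E (i, i) x0 = l i *: (x0 : W) /\ E (i, i) x1 = l i *: (x1 : W).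
  have hgen : hB false (alg_gen SB (i, i)).
    by have := alg_hom_gen SB (leqnn _ : DP (i, i)); rewrite /unit_odd addbb.
  have [|||e0 e1] := @grading_sum0 _ _ V gV false (E (i, i) x0 - l i *: (x0 : W))
     (E (i, i) x1 - l i *: (x1 : W)) hgr.
  - by have [_ gB] := hB0 false; apply: gB; [exact: hZ hgen g0|exact: Zk].
  - by have [_ gB] := hB0 true; apply: gB; [exact: hZ hgen g1|exact: Zk].
  - have := lv i; rewrite ev linearD scalerDr => e.
    by apply/eqP; rewrite addrACA -opprD subr_eq0; apply/eqP.
  by split; apply/eqP; rewrite -subr_eq0; apply/eqP.
have [x00|x00] := eqVneq x0 0; last first.
  by exists false, l, x0; split=> // [i|r /hx[]//]; case: (lx i).
exists true, l, x1; split=> // [|i|r /hx[]//]; last by case: (lx i).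
by apply: contraNneq v0 => x10; rewrite ev x00 x10 addr0.
Qed.

(** All roots of the parabolic subalgebra outside the strictly lower ones within a block preserve
    the highest weight line. Hence the finitely many reduced monomials in the latter span; their
    full powers may be nonzero scalars here. *)
Lemma parabolic_finite_dim : exists d (b : 'I_d -> W), is_basis b.
Proof.
have p_gt1 : (1 < p)%N by exact: ltnW.
have [hgr _ simple] := V_simple; have [hB0 hZ _ _] := hgr.
have [k [l [v [v0 gv lv hv]]]] := parabolic_homog_highest.
pose Q (r : idx) := (r.2 < r.1)%N && (beta r.1 == beta r.2).
pose ht (r : idx) := (r.1 - r.2)%N.
have QD r : Q r -> DP r by case/andP=> _ /eqP ->.
have ht0 r : Q r -> (0 < ht r)%N by case/andP; rewrite /ht subn_gt0.
have Qadd r s : Q r -> Q s -> r.2 = s.1 ->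
    Q (r.1, s.2) /\ ht (r.1, s.2) = (ht r + ht s)%N.
  case: r s => [a b] [d e]; rewrite /Q /ht /= => /andP[h1 /eqP h2] /andP[h3 /eqP h4] h5.
  by subst d; rewrite h2 h4 eqxx; split; lia.
pose Y (z : W) := exists a : F, z = a *: v.
have sY : subspace Y.
  split=> [|a _ _ [b ->] [b' ->]]; first by exists 0; rewrite scale0r.
  by exists (a * b + b'); rewrite scalerDl scalerA.
have YE r y : DP r -> ~~ Q r -> Y y -> Y (E r y).
  move=> Dr nQ [a ->]; rewrite linearZ; apply: subspaceZ => //.
  have := nQ; rewrite /Q negb_and -leqNgt leq_eqVlt -orbA.
  case/or3P=> [/eqP/val_inj e|h|h].
  - by case: r e {Dr nQ} => i j /= <-; exists (l i); exact: lv.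
  - by exists 0; rewrite scale0r hv.
  exists 0; rewrite scale0r; apply: hv; rewrite /raising.
  have : (beta r.1 < beta r.2)%N by rewrite ltn_neqAle h.
  by apply: contraTT; rewrite -!leqNgt; exact: beta_mono.
have gen x : generated E Q Y x.
  have sG : subspace (generated E Q Y).
    by split; [exact: generated0|move=> a y w; exact: generatedP].
  have : exists a, x = a *: (v : V).
    move: x; apply: simple; last by exists v; split=> //; exists 1; rewrite scale1r.
    split.
    - by exists 0; rewrite scale0r.
    - by move=> _ _ [a ->] [b ->]; exists (a - b); rewrite scalerBl.
    - by move=> a _ [b ->]; exists (a * b); rewrite scalerA.
    move=> x0 x1 g0 g1 [a e]; have [a0 [a1 [h0 h1 ea]]] := alg_homog_split SB a.
    have ga0 := hZ _ _ _ _ h0 gv; have ga1 := hZ _ _ _ _ h1 gv.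
    have [gB0 gB1] := (hB0 false, hB0 true).
    move: e; rewrite ea scalerDl.
    case: k {gv} ga0 ga1 => /= ga0 ga1 e.
      (* For odd [v] the parities are exchanged: [a1 *: v] is the even component. *)
      have [|||e0 e1] := @grading_sum0 _ _ V gV false (x0 - a1 *: (v : V)) (x1 - a0 *: (v : V)) hgr.
      - by case: gB0 => _; apply.
      - by case: gB1 => _; apply.
      - by rewrite addrACA -opprD e [a1 *: _ + _]addrC subrr.
      by move/eqP: e0; move/eqP: e1; rewrite !subr_eq0 => /eqP -> /eqP ->; split;
        [exists a1|exists a0].
    have [|||e0 e1] := @grading_sum0 _ _ V gV false (x0 - a0 *: (v : V)) (x1 - a1 *: (v : V)) hgr.
    - by case: gB0 => _; apply.
    - by case: gB1 => _; apply.
    - by rewrite addrACA -opprD e subrr.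
    by move/eqP: e0; move/eqP: e1; rewrite !subr_eq0 => /eqP -> /eqP ->; split;
      [exists a0|exists a1].
  case=> a ->;
    apply: (@alg_stable _ _ _ _ _ _ _ _ SB V (generated E Q Y) sG) => [r z Dr gz|].
    apply: (@generated_stable _ _ _ _ _ _ _ E Q QD Y r z) => //.
    by move=> i j h /= h1 h2; exact: leq_trans h1 h2.
  by apply: generated_in; exists 1; rewrite scale1r.
pose qs := ht_enum Q ht; pose ex := exponents par p qs.
apply: (@exists_basis F W (size ex) (fun i => monomial E qs (nth [::] ex i) v)) => x.
have [g [Yg ->]] := generated_monomials QD ht0 Qadd p_gt1 sY (gen x).
have {Yg} /choice[a ga] : forall J, exists a, g J = a *: v by exact: Yg.
exists (fun i => a (nth [::] ex i)).
rewrite (big_nth [::]) big_mkord; apply: eq_bigr => i _.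
by rewrite ga linearZ.
Qed.
End ParabolicModule.

(** * The induced module and its dimension *)

Section InducedModule.
Variables (F : closedFieldType) (N : nat) (par : 'I_N -> bool) (p : nat).
Hypotheses (p_char : p \in [pchar F]) (p_gt2 : (2 < p)%N).
Local Notation idx := ('I_N * 'I_N)%type.
Variables (c : idx -> F) (chi : 'I_N -> F) (beta : 'I_N -> nat).
Hypothesis beta_mono : forall i j : 'I_N, (i <= j)%N -> (beta i <= beta j)%N.
Hypothesis c_diag : forall i, c (i, i) = chi i ^+ p.
Hypothesis c_low : forall r, lowering beta r -> c r = 0.
Hypothesis c_raise : forall r, raising r -> c r = 0.
Hypothesis chi_lt : forall i j, (beta i < beta j)%N ->
  chi i - (-1) ^+ unit_odd par (i, j) * chi j != 0.

Local Notation DP := (fun r : idx => (beta r.1 <= beta r.2)%N).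

Variables (A B : pzRingType) (hA : bool -> A -> Prop) (hB : bool -> B -> Prop).
Variables (SA : unit_algebra par p predT c hA) (SB : unit_algebra par p DP c hB).
Variable f : {rmorphism B -> A}.
Hypothesis f_cst : forall a, f (alg_cst SB a) = alg_cst SA a.
Hypothesis f_gen : forall r, DP r -> f (alg_gen SB r) = alg_gen SA r.

Variables (M : lmodType A) (gM : bool -> M -> Prop).
Hypothesis M_simple : graded_simple hA gM.
Variables (V : lmodType B) (gV : bool -> V -> Prop).
Hypothesis V_simple : graded_simple hB gV.
Variable iota : {additive V -> M}.
Hypothesis iota_inj : injective iota.
Hypothesis iota_lin : forall b v, iota (b *: v) = f b *: iota v.
Hypothesis iota_deg : forall k v, gV k v -> gM k (iota v).

Local Notation WM := (restrict_scalars (alg_cst SA) M).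
Local Notation WV := (restrict_scalars (alg_cst SB) V).
Local Notation T := (tensor f V).
Local Notation WT := (restrict_scalars (alg_cst SA) T).
Let E : unit_action par p predT c WM := alg_action SA M.
Let ET : unit_action par p predT c WT := alg_action SA T.
Let ys := ht_enum (lowering beta) (lowering_ht beta).
Let ex := exponents par p ys.
Let p_gt1 : (1 < p)%N. Proof. exact: ltnW. Qed.
Let QD : forall r, lowering beta r -> predT r. Proof. by []. Qed.

Lemma iota_linear : linear (iota : WV -> WM).
Proof.
by move=> a v w; rewrite raddfD !restrict_scaleE iota_lin f_cst.
Qed.

Lemma monomial_iota_free (v : seq nat -> V) :
  \sum_(J <- ex) monomial E ys J (iota (v J)) = 0 ->
  forall J, J \in ex -> v J = 0.
Proof.
move=> sum0 J hJ; apply: iota_inj; rewrite raddf0.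
pose Y (z : WM) := exists v : WV, z = iota v.
have sY : subspace Y.
  split=> [|a _ _ [x ->] [y ->]]; first by exists 0; rewrite raddf0.
  by exists (a *: x + y); rewrite iota_linear.
refine (@monomial_free F N par p predT c WM E (lowering beta) (lowering_ht beta)
  QD (@lowering_gt0 N beta) (@lowering_add N beta) p_gt1 c_low Y ys
  (fun J => iota (v J)) _ _ _ _ _ _ sum0 J hJ).
- by case: sY.
- by case: sY.
- exact: ht_segment_enum.
- by move=> z _ r Qr; rewrite mem_ht_enum Qr.
- apply: (top_op_inj p_char p_gt2 beta_mono c_diag c_low c_raise chi_lt) => //.
    move=> r _ Dr [x ->]; exists (alg_gen SB r *: (x : V)).
    by rewrite iota_lin f_gen.
  move=> r _ Dr [x ->].
  have := iota_lin (alg_gen SB r) x; rewrite f_gen ?(ltnW Dr) // => e.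
  rewrite [LHS](esym e).
  by rewrite (nilradical_trivial p_char p_gt2 beta_mono c_raise SB V_simple) // raddf0.
by move=> I; exists (v I).
Qed.

(** Operators of the parabolic subalgebra pass through the tensor sign, so the vectors $1\otimes v$
    are stable under them and only lowering operators remain. *)
Lemma tensor_monomials (t : T) : exists v : seq nat -> V,
  t = \sum_(J <- ex) monomial ET ys J (tens f 1 (v J)).
Proof.
pose Y (z : WT) := exists v : V, z = tens f 1 v.
have sY : subspace Y.
  split=> [|a _ _ [x ->] [y ->]].
    by exists 0; apply: (addrI (tens f 1 0)); rewrite addr0 -tensDr addr0.
  exists (alg_cst SB a *: x + y); rewrite tensDr -tens_balanced f_cst mul1r.
  by rewrite restrict_scaleE tensZ mulr1.
have sG : subspace (generated ET (lowering beta) Y).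
  by split; [exact: generated0|move=> a y w; exact: generatedP].
have gen (x : WT) : generated ET (lowering beta) Y x.
  elim/tens_ind: x => [|s s'|a v]; first by case: sG.
    exact: (@subspaceD F WT _ s s' sG).
  rewrite -[a]mulr1 -tensZ.
  apply: (@alg_stable _ _ _ _ _ _ _ _ SA T _ sG) => [r z _ gz|]; last first.
    by apply: generated_in; exists v.
  apply: (@generated_stable _ _ _ _ _ _ _ ET (lowering beta) QD Y r z) => //.
  move=> {gz}s _ _ nQ [x ->]; exists (alg_gen SB s *: x).
  rewrite -tens_balanced mul1r f_gen; last by rewrite leqNgt.
  by rewrite -[LHS]/(alg_gen SA s *: tens f 1 x) tensZ mulr1.
have [g [Yg ->]] := generated_monomials QD (@lowering_gt0 N beta)
  (@lowering_add N beta) p_gt1 sY (gen t).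
have [v gv] := choice Yg; exists v.
by apply: eq_bigr => J _; rewrite gv.
Qed.

Lemma tens_lift_monomials (v : seq nat -> V) :
  tens_lift iota_lin (\sum_(J <- ex) monomial ET ys J (tens f 1 (v J))) =
  \sum_(J <- ex) monomial E ys J (iota (v J)).
Proof.
rewrite linear_sum; apply: eq_bigr => J _.
apply: etrans (@monomial_morph F N par p predT c WT WM ET E (tens_lift iota_lin) _ ys J _) _.
  move=> r z; rewrite -[LHS]/(tens_lift iota_lin (alg_gen SA r *: (z : T))).
  by rewrite linearZ.
by rewrite tens_liftE scale1r.
Qed.

(** An element of the kernel is a sum of monomials whose image is a relation in [M]; independence
    there forces every coefficient to vanish. *)
Lemma tens_lift_inj : injective (tens_lift iota_lin).
Proof.
move=> s t est; apply/eqP; rewrite -subr_eq0; apply/eqP.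
have [v e] := tensor_monomials (s - t).
have : tens_lift iota_lin (s - t) = 0 by rewrite linearB /= est subrr.
rewrite e tens_lift_monomials => /monomial_iota_free v0.
apply: big1_seq => J /andP[_ hJ]; rewrite v0 // (_ : tens f 1 0 = 0) ?linear0 //.
by apply: (addrI (tens f 1 0)); rewrite addr0 -tensDr addr0.
Qed.

Theorem induced_iso_dim :
  graded_iso gM (tens_hom hA (f := f) gV) /\
  exists d, has_dim (alg_cst SB) V d /\ has_dim (alg_cst SA) M (size ex * d).
Proof.
have [[hV0 _ V_split _] V_nz _] := V_simple.
have [iso surj] := induced_graded_iso (iota_lin := iota_lin) (alg_homog_split SA) V_split
  (fun k => (hV0 k).1) M_simple iota_deg V_nz iota_inj tens_lift_inj.
split=> //.
have [d [b hb]] := parabolic_finite_dim p_char p_gt2 beta_mono c_raise SB V_simple.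
exists d; split.
  by have := has_dim_basis hb; rewrite card_ord.
pose exn (i : 'I_(size ex)) := nth [::] ex i.
pose B' (t : 'I_(size ex) * 'I_d) : WM := monomial E ys (exn t.1) (iota (b t.2)).
have exU : uniq ex by exact: exponents_uniq.
have sumE (a : 'I_(size ex) * 'I_d -> F) (v : seq nat -> WV) :
    (forall i, v (exn i) = \sum_j a (i, j) *: b j) ->
    \sum_(J <- ex) monomial E ys J (iota (v J)) = \sum_t a t *: B' t.
  move=> hv; rewrite (big_nth [::]) big_mkord.
  transitivity (\sum_i \sum_j a (i, j) *: B' (i, j)); last first.
    by rewrite pair_big; apply: eq_bigr => -[i j].
  apply: eq_bigr => i _; rewrite -/(exn i) hv.
  rewrite -[iota _]/((iota : WV -> WM) _).
  pose il : {linear WV -> WM} := HB.pack (iota : WV -> WM)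
    (GRing.isLinear.Build F WV WM _ (iota : WV -> WM) iota_linear).
  rewrite -[iota _]/(il _) !linear_sum; apply: eq_bigr => j _.
  by rewrite (linearZ_LR il) linearZ_LR.
have : is_basis B'.
  apply: is_basisP => [x|a sum0 [i j]].
    have [t ->] := surj x; have [v ->] := tensor_monomials t.
    rewrite tens_lift_monomials.
    have /choice[a ha] : forall i, exists a : 'I_d -> F, (v (exn i) : WV) = \sum_j a j *: b j.
      by move=> i; have [a [-> _]] := hb (v (exn i)); exists a.
    by exists (fun t => a t.1 t.2); apply: sumE => i'; rewrite ha.
  (* Passes from positions to exponents; exponents are not repeated, so at most one [i]
     contributes. *)
  pose v J : WV := \sum_(i | exn i == J) \sum_j a (i, j) *: b j.
  have hv i' : v (exn i') = \sum_j a (i', j) *: b j.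
    rewrite /v (big_pred1 i') // => i2; rewrite /exn nth_uniq //.
  have := monomial_iota_free (v := v); rewrite (sumE _ _ hv) => /(_ sum0 (exn i)).
  rewrite mem_nth // hv => /(_ isT) e.
  have [a0 [_ u0]] := hb 0.
  have e1 : a0 = [ffun=> 0] by apply: u0; rewrite big1 // => j' _; rewrite ffunE scale0r.
  have : a0 = [ffun j => a (i, j)].
    by apply: u0; rewrite -[LHS]e; apply: eq_bigr => j' _; rewrite ffunE.
  by rewrite e1 => /ffunP/(_ j); rewrite !ffunE.
by move/has_dim_basis; rewrite card_prod !card_ord.
Qed.
End InducedModule.

Section Inclusion.
Variables (F : fieldType) (m n p : nat).
Local Notation gl := 'M[F]_(m + n).
Variables (chi : {scalar gl}) (L : {vspace gl}).

Lemma u_incl_cst a : u_incl (ucst p chi L a) = ucst p chi fullv a.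
Proof.
by rewrite /u_incl /ucst rq_liftE /= /u_incl0 /= U_incl_cst.
Qed.

Lemma u_incl_unit_gen r : unit_mx F r \in L ->
  u_incl (unit_gen p chi L r) = unit_gen p chi fullv r.
Proof. by move=> hr; rewrite /unit_gen u_incl_gen /incl vsprojK. Qed.
End Inclusion.

Theorem theorem5p15 (F : closedFieldType) (p m n : nat)
    (p_char : p \in [pchar F]) (p_gt3 : (3 < p)%N) (mn : (m, n) != (1%N, 1%N))
    (chi : {scalar 'M[F]_(m + n)})
    (* chi is extended by zero to the odd part and vanishes on N^+ *)
    (chi_odd : forall x, homog true x -> chi x = 0)
    (chi_npos : forall r, pos_root r -> chi (delta_mx r.1 r.2) = 0)
    (* chi_n vanishes on g_{-alpha} for alpha in Phi' *)
    (chin_Phi' : forall r, Phi' chi r -> chin chi (delta_mx r.2 r.1) = 0)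
    (parab_subalg : subalg (parab chi))
    (parab_nil : is_nilradical (parab chi) (levi' chi) (nilrad chi))
    (M : lmodType (u p chi fullv)) (gM : bool -> M -> Prop)
    (M_simple : graded_simple (@u_hom _ _ _ p chi fullv) gM)
    (M' : lmodType (u p chi (parab chi))) (gM' : bool -> M' -> Prop)
    (M'_simple : graded_simple (@u_hom _ _ _ p chi (parab chi)) gM')
    (* iota is the inclusion of the graded submodule M' *)
    (iota : {additive M' -> M}) (iota_inj : injective iota)
    (iota_lin : forall a v, iota (a *: v) = u_incl a *: iota v)
    (iota_deg : forall k v, gM' k v <-> gM k (iota v)) :
  graded_iso gM
    (tens_hom (@u_hom _ _ _ p chi fullv) (f := @u_incl _ _ _ p chi (parab chi)) gM')
  /\ exists d : nat,
       has_dim (@ucst _ _ _ p chi (parab chi)) M' d /\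
       has_dim (@ucst _ _ _ p chi fullv) M
         (p ^ \dim (nil_part chi false) * 2 ^ \dim (nil_part chi true) * d)%N.
Proof.
have p_gt2 : (2 < p)%N by exact: ltnW.
have p_gt0 : (0 < p)%N by exact: leq_trans p_gt2.
have full r : predT r -> unit_mx F r \in (fullv : {vspace 'M[F]_(m + n)}).
  by move=> _; exact: memvf.
have Pu := parab_unit parab_subalg parab_nil.
have Ptr i j k : parab_root chi (i, j) -> parab_root chi (j, k) -> parab_root chi (i, k).
  exact: leq_trans.
have Psp := parab_span parab_subalg parab_nil.
pose SA := envelope_algebra p_char p_gt2 chi_odd full (fun _ _ _ _ _ => isT)
  (fun _ _ _ _ _ => isT).
pose SB := envelope_algebra p_char p_gt2 chi_odd Pu Ptr Psp.
have := @induced_iso_dim F (m + n) (@idx_odd m n) p p_char p_gt2 (unit_char p chi)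
  (diag_char chi) (block chi) (block_mono parab_subalg parab_nil) (fun=> erefl)
  (fun r => unit_char_lowering chin_Phi' parab_subalg parab_nil p_gt0)
  (fun r => unit_char_raising chi_npos p_gt0)
  (diag_char_neq (chi := chi))
  _ _ _ _ SA SB (@u_incl F m n p chi (parab chi))
  (@u_incl_cst F m n p chi (parab chi))
  (fun r Dr => u_incl_unit_gen p chi (Pu r Dr))
  M gM M_simple M' gM' M'_simple iota iota_inj iota_lin
  (fun k v => (iota_deg k v).1).
by rewrite size_exponents_lowering.
Qed.
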